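(* Let $t\in(0,\infty)$ and let $p_t(z,\overline{z})=z^2\overline{z}+tz\overline{z}^2+\frac{t^2}{3}\overline{z}^3$. Let $M_t\subset\mathbb{C}^2$ be a real surface with an isolated CR singularity at the origin (of order three) such that, for some $r>0$, $$M_t\cap\overline{B(0;r)}=\{(z,w)\in\overline{B(0;r)}: w=p_t(z,\overline{z})+F(z,\overline{z})\},$$ where $F(z,\overline{z})=o(|z|^3)$ as $z\to0$. If $t\ge\sqrt{\tfrac{3}{2}}$, then $M_t$ is locally polynomially convex at the origin.
   Context: For a compact set $K\subset\mathbb{C}^n$, the polynomially convex hull is $\widehat{K}=\{z\in\mathbb{C}^n: |p(z)|\le\sup_K|p| \text{ for all } p\in\mathbb{C}[z_1,\dots,z_n]\}$; $K$ is polynomially convex if $\widehat{K}=K$. A closed set $E\subset\mathbb{C}^n$ is locally polynomially convex at $p\in E$ if $E\cap\overline{B(p;r)}$ is polynomially convex for some $r>0$, where $B(p;r)$ is the open ball in $\mathbb{C}^n$ with centre $p$ and radius $r$. A real surface in $\mathbb{C}^2$ is a 2-dimensional real submanifold $M$ of $\mathbb{C}^2$; it is totally real at $p\in M$ if $T_pM\cap iT_pM=\{0\}$, and has a CR singularity at $p$ if it is not totally real at $p$ (i.e. $T_pM$ is a complex subspace of $\mathbb{C}^2$). The CR singularity at the origin has order three when the lowest-degree homogeneous term of the local graphing function is a nonholomorphic homogeneous polynomial in $z,\overline{z}$ of degree $3$ (here, $p_t$). *)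

(* Defs.v *)
From HB Require Import structures.
From mathcomp Require Import all_boot all_order all_algebra.
From mathcomp Require Import all_classical all_reals all_analysis.
From mathcomp Require Import complex.

Set Implicit Arguments.
Unset Strict Implicit.
Unset Printing Implicit Defensive.

Import Order.TTheory GRing.Theory Num.Theory.
Import numFieldNormedType.Exports.

Local Open Scope classical_set_scope.
Local Open Scope ring_scope.

(* [Rcomplex R] is the type R[i] seen as a real vector space with its
   R-valued modulus; differentiability below is over R. *)
Section RcomplexNormed.
Variable R : realType.

Lemma Rcomplex_normrZ (a : R) (z : Rcomplex R) : `|a *: z| = `|a| * `|z|.
Proof.
case: z => x y; rewrite /Num.norm /= !exprMn -mulrDr.
by rewrite sqrtrM ?sqr_ge0 // sqrtr_sqr.
Qed.

HB.instance Definition _ :=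
  PseudoMetric.copy (Rcomplex R) (pseudoMetric_normed (Rcomplex R)).
HB.instance Definition _ := isPointed.Build (Rcomplex R) 0.
HB.instance Definition _ :=
  NormedZmod_PseudoMetric_eq.Build R (Rcomplex R) erefl.
HB.instance Definition _ :=
  PseudoMetricNormedZmod_Lmodule_isNormedModule.Build R (Rcomplex R)
    Rcomplex_normrZ.

End RcomplexNormed.

Notation C2 R := (Rcomplex R * Rcomplex R)%type.

(* The norm that C2 R inherits as a product is the max norm (same topology);
   the balls of C^2 are Euclidean. *)
Definition enorm (R : realType) (q : C2 R) : R :=
  Num.sqrt (`|q.1| ^+ 2 + `|q.2| ^+ 2).

Definition eclosed_ball (R : realType) (p : C2 R) (r : R) : set (C2 R) :=
  [set q | enorm (q - p) <= r].

(* C[z_1, z_2] is {poly {poly Rcomplex R}}, with the outer variable z_1. *)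
Definition eval2 (R : realType) (p : {poly {poly Rcomplex R}}) (z : C2 R) :
  Rcomplex R := p.[z.1, z.2].

Definition polynomial_hull (R : realType) (K : set (C2 R)) : set (C2 R) :=
  [set z | forall p : {poly {poly Rcomplex R}},
    `|eval2 p z| <= sup [set `|eval2 p x| | x in K]].

Definition polynomially_convex (R : realType) (K : set (C2 R)) : Prop :=
  compact K /\ polynomial_hull K = K.

Definition locally_polynomially_convex_at (R : realType)
    (E : set (C2 R)) (p : C2 R) : Prop :=
  E p /\
  exists2 r : R, 0 < r & polynomially_convex (E `&` eclosed_ball p r).

(* Real C^k regularity on an open set U; V is meant to be finite-dimensional,
   so that it suffices to iterate directional derivatives. *)
Fixpoint class_C (R : realType) (V W : normedModType R) (k : nat)
    (U : set V) (f : V -> W) : Prop :=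
  match k with
  | 0 => forall x, U x -> {for x, continuous f}
  | k'.+1 => (forall x, U x -> differentiable f x) /\
             forall v : V, class_C k' U ('D_v f)
  end.

(* Embedded 2-dimensional real submanifold of C^2, of class C^k: near each of
   its points there is a C^k diffeomorphism Phi : U -> U' between open sets,
   with inverse Psi, that carries M `&` U onto the slice U' `&` (C x {0}). *)
Definition real_surface (R : realType) (k : nat) (M : set (C2 R)) : Prop :=
  forall p, M p -> exists (U U' : set (C2 R)) (Phi Psi : C2 R -> C2 R),
    [/\ open U /\ U p, open U',
        class_C k U Phi /\ (forall q, U q -> U' (Phi q) /\ Psi (Phi q) = q),
        class_C k U' Psi /\ (forall q, U' q -> U (Psi q) /\ Phi (Psi q) = q) &
        forall q, U q -> (M q <-> (Phi q).2 = 0)].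

(* Velocities at p of C^1 curves in M through p. *)
Definition tangent_space (R : realType) (M : set (C2 R)) (p : C2 R)
    : set (C2 R) :=
  [set v | exists (e : R) (gamma : R -> C2 R),
    [/\ 0 < e, class_C 1 (ball 0 e) gamma,
        forall s, ball 0 e s -> M (gamma s),
        gamma 0 = p & 'D_1 gamma 0 = v]].

Definition mul_i (R : realType) (v : C2 R) : C2 R :=
  (('i%C : Rcomplex R) * v.1, ('i%C : Rcomplex R) * v.2).

Definition totally_real_at (R : realType) (M : set (C2 R)) (p : C2 R) : Prop :=
  tangent_space M p `&` [set mul_i v | v in tangent_space M p] = [set 0].

Definition CR_singularity (R : realType) (M : set (C2 R)) (p : C2 R) : Prop :=
  M p /\ ~ totally_real_at M p.

Definition isolated_CR_singularity (R : realType) (M : set (C2 R))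
    (p : C2 R) : Prop :=
  CR_singularity M p /\ \forall q \near p^', ~ CR_singularity M q.

Definition p_t (R : realType) (t : R) (z : Rcomplex R) : Rcomplex R :=
  let zbar : Rcomplex R := conjc z in
  z ^+ 2 * zbar + t *: (z * zbar ^+ 2) + (t ^+ 2 / 3) *: zbar ^+ 3.

(* Main.v *)
(* Since 3 t p_t = (z + t zbar)^3 - z^3, the polynomial automorphism
   (z, w) |-> (z, 3 t w + z^3) turns the surface into W = u^3 + o(|z|^3), where
   u = z + t zbar; its preimage under (z, zeta) |-> (z, zeta^3) consists of the
   perturbed totally real planes zeta = omega^j u + o(|z|), omega^3 = 1.  Let v be
   the cube root of W close to u.  For t^2 >= 3/2 the values of phi = z v lie in
   the sector |arg| <= arctan(8/5) < pi/3, so that z^3 W = phi^3 omits a sector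
   around the negative axis.  By pushing a pole along that axis, phi is a uniform
   limit of polynomials in z^3 W, and therefore z^2 v^n is a uniform limit of
   polynomials in z and w for every n.  A point of the hull over a <> 0 is then
   excluded by the functions z^2 (v - v(a)) (1 - lambda h)^n, where
   h = (z - a)(v - v(a) - (z - a)) is close to t |z - a|^2 on the surface; over
   a = 0 one uses W (1 - lambda phi)^n.

   That h behaves so well requires |F(z) - F(a)| <= eps rho^2 |z - a| for |z| and
   |a| at most rho, which is where the smoothness of the surface enters: in a C^3
   parametrization by x, the function F(A(x)) is C^3 and o(|x|^3), so
   interpolation by the mean value theorem makes its gradient o(|x|^2). *)
Require Import Defs.
From HB Require Import structures.
From mathcomp Require Import all_boot all_order all_algebra.
From mathcomp Require Import all_classical all_reals all_analysis.
From mathcomp Require Import complex.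
From mathcomp Require Import ring lra.

Set Implicit Arguments.
Unset Strict Implicit.
Unset Printing Implicit Defensive.

Import Order.TTheory GRing.Theory Num.Theory.
Import numFieldNormedType.Exports.

Local Open Scope classical_set_scope.
Local Open Scope ring_scope.

(** * Complex numbers *)

(** The threshold: for [z = x + i y] the product [z (z + t zbar)] has real part
    [(1 + t) x^2 + (t - 1) y^2] and imaginary part [2 x y], so its slope is at most
    [1 / sqrt(t^2 - 1)], hence at most [sqrt 2] when [t^2 >= 3/2]. The constants 3/2, 8/5 and 17/10
    lie between [sqrt 2] and [sqrt 3], the slope of the angle pi/3; the gaps between them absorb the
    perturbation by [F] and the approximation errors. The obstacle is that the polynomial [W] gives
    [v] only up to a cube root of unity. The product [z v] is recovered from its cube because cubing
    is injective on the sector, and this selects one of the three sheets. At a point [q0] of the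
    hull outside [K], the number [v] has no meaning beforehand. Its substitute comes from a cube
    root of [z^3 W] at [q0], chosen such that polynomials converging to [z v] on [K] converge to
    that root at [q0]. From then on every function lives on [K] together with [q0]. *)

Section ComplexNumbers.
Variable R : realType.
Local Notation C := (Rcomplex R).
Local Notation nrm x := (`|(x : C)|).
Local Notation Re := (@complex.Re R).
Local Notation Im := (@complex.Im R).
Implicit Types x y z u c : C.

Lemma ReM x y : Re (x * y) = Re x * Re y - Im x * Im y.
Proof. by case: x => ? ?; case: y. Qed.

Lemma ImM x y : Im (x * y) = Re x * Im y + Im x * Re y.
Proof. by case: x => ? ?; case: y. Qed.

Lemma ReD x y : Re (x + y) = Re x + Re y. Proof. by case: x; case: y. Qed.
Lemma ImD x y : Im (x + y) = Im x + Im y. Proof. by case: x; case: y. Qed.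
Lemma ReN x : Re (- x) = - Re x. Proof. by case: x. Qed.
Lemma ImN x : Im (- x) = - Im x. Proof. by case: x. Qed.

Lemma Re_scale (a : R) x : Re (a *: x) = a * Re x. Proof. by case: x. Qed.
Lemma Im_scale (a : R) x : Im (a *: x) = a * Im x. Proof. by case: x. Qed.

Lemma Re_conj x : Re (conjc x) = Re x. Proof. by case: x. Qed.
Lemma Im_conj x : Im (conjc x) = - Im x. Proof. by case: x. Qed.

Definition ReImE := (ReM, ImM, ReD, ImD, ReN, ImN, Re_scale, Im_scale,
  Re_conj, Im_conj).

Lemma ReIm_inj x y : Re x = Re y -> Im x = Im y -> x = y.
Proof. by case: x => ? ?; case: y => ? ? /= -> ->. Qed.

Lemma RcnormE z : `|z| = Num.sqrt (Re z ^+ 2 + Im z ^+ 2).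
Proof. by case: z. Qed.

Lemma Rcnorm_sqr z : `|z| ^+ 2 = Re z ^+ 2 + Im z ^+ 2.
Proof. by rewrite RcnormE sqr_sqrtr // addr_ge0 ?sqr_ge0. Qed.

Lemma RcnormM x y : nrm (x * y) = nrm x * nrm y.
Proof. exact: ComplexField.Normc.normcM. Qed.

Lemma Rcnorm1 : nrm 1 = 1. Proof. exact: ComplexField.Normc.normc1. Qed.

Lemma Rcnorm_nat n : nrm n%:R = n%:R.
Proof. by rewrite (_ : n%:R = (n%:R : R) *: (1 : C)) ?normrZ ?Rcnorm1 ?mulr1 ?normr_nat // scaler_nat. Qed.

Lemma RcnormX x n : nrm (x ^+ n) = `|x| ^+ n.
Proof.
by elim: n => [|n IH]; rewrite ?expr0 ?Rcnorm1 // !exprS RcnormM IH.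
Qed.

Lemma RcnormV x : nrm (x^-1) = `|x|^-1.
Proof. exact: ComplexField.Normc.normcV. Qed.

Lemma RcnormJ x : nrm (conjc x) = `|x|.
Proof. by rewrite !RcnormE Re_conj Im_conj sqrrN. Qed.

Lemma Rc_mulrZ (a : R) x y : x * (a *: y) = a *: (x * y).
Proof. by rewrite mulrC -scalerAl mulrC. Qed.

Lemma Rc_exprZ (a : R) x n : (a *: x) ^+ n = a ^+ n *: x ^+ n.
Proof.
elim: n => [|n IH]; first by rewrite !expr0 scale1r.
by rewrite !exprS IH -scalerAl Rc_mulrZ scalerA.
Qed.

Lemma Re_le_norm z : `|Re z| <= `|z|.
Proof.
rewrite -(@ler_pXn2r _ 2) ?nnegrE ?normr_ge0 // Rcnorm_sqr real_normK ?num_real //.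
by rewrite lerDl sqr_ge0.
Qed.

Lemma Im_le_norm z : `|Im z| <= `|z|.
Proof.
rewrite -(@ler_pXn2r _ 2) ?nnegrE ?normr_ge0 // Rcnorm_sqr real_normK ?num_real //.
by rewrite lerDr sqr_ge0.
Qed.

Lemma norm_le_ReIm z : `|z| <= `|Re z| + `|Im z|.
Proof.
rewrite -(@ler_pXn2r _ 2) ?nnegrE ?addr_ge0 ?normr_ge0 // Rcnorm_sqr.
rewrite sqrrD !real_normK ?num_real //.
have := mulr_ge0 (normr_ge0 (Re z)) (normr_ge0 (Im z)); lra.
Qed.

Lemma cuberoots c : exists a b d : C,
  forall u, u ^+ 3 - c = (u - a) * (u - b) * (u - d).
Proof.
have [r] := closed_field_poly_normal ('X^3 - c%:P : {poly C}).
have mon : 'X^3 - c%:P \is @monic C by rewrite monicXnsubC.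
rewrite (monicP mon) scale1r => E.
have := size_XnsubC c (ltn0Sn 2); rewrite E size_prod_XsubC => -[].
move: E; case: r => [|a [|b [|d []]]]// E _; exists a, b, d => u.
have := congr1 (fun p => p.[u]) E.
by rewrite !big_cons big_nil mulr1 !hornerE.
Qed.

(** The distances from [u] to the three cube roots of [c] have product [|c - u^3|], so the cube of
    the smallest is at most that. *)
Lemma cuberoot_near c u : exists2 x, x ^+ 3 = c & nrm (x - u) ^+ 3 <= nrm (c - u ^+ 3).
Proof.
have [a [b [d E]]] := cuberoots c.
have root x : (x - a) * (x - b) * (x - d) = 0 -> x ^+ 3 = c.
  by rewrite -E => /eqP; rewrite subr_eq0 => /eqP.
have Hu : nrm (c - u ^+ 3) = nrm (a - u) * nrm (b - u) * nrm (d - u).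
  by rewrite distrC E !RcnormM !(distrC u).
have ha : a ^+ 3 = c by apply: root; ring.
have hb : b ^+ 3 = c by apply: root; ring.
have hd : d ^+ 3 = c by apply: root; ring.
have min3 (p q r : R) : 0 <= p -> p <= q -> p <= r -> p ^+ 3 <= p * q * r.
  move=> p0 pq pr; rewrite !exprS expr0 mulr1 mulrA.
  by apply: ler_pM => //; [exact: mulr_ge0|exact: ler_pM].
have [ab|/ltW ba] := leP (nrm (a - u)) (nrm (b - u)).
  have [ad|/ltW da] := leP (nrm (a - u)) (nrm (d - u)).
    by exists a => //; rewrite Hu min3.
  exists d => //; rewrite Hu mulrC mulrA min3 //; exact: le_trans da ab.
have [bd|/ltW db] := leP (nrm (b - u)) (nrm (d - u)).
  by exists b => //; rewrite Hu (mulrC (nrm (a - u))) min3.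
exists d => //; rewrite Hu mulrC mulrA min3 //; exact: le_trans db ba.
Qed.

End ComplexNumbers.

(** * Sectors and cubes *)

Section Bernoulli.
Variable R : realFieldType.

Lemma bernoulli_decay (y : R) n : 0 <= y <= 1 -> (1 - y) ^+ n * (1 + n%:R * y) <= 1.
Proof.
move=> /andP[y0 y1]; elim: n => [|n IH]; first by rewrite mul0r addr0 mulr1.
have p0 : 0 <= (1 - y) ^+ n by rewrite exprn_ge0 // subr_ge0.
apply: le_trans IH; rewrite exprS [_ * (1 - y) ^+ n]mulrC -mulrA ler_wpM2l // -natr1.
have : 0 <= n%:R * y ^+ 2 by rewrite mulr_ge0 ?ler0n ?sqr_ge0.
have := sqr_ge0 y; lra.
Qed.

(** The bound is uniform in [y]. A function dominated by [y] therefore tends to zero uniformly when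
    multiplied by [(1 - y)^n], even where [y] is close to 0. *)
Lemma mul_pow_decay (y : R) n : 0 <= y <= 1 -> n%:R * (y * (1 - y) ^+ n) <= 1.
Proof.
move=> y01; have := bernoulli_decay n y01; move: y01 => /andP[y0 y1].
have : 0 <= (1 - y) ^+ n by rewrite exprn_ge0 // subr_ge0.
rewrite mulrDr mulr1; set e := (_ ^+ _); move=> h1 h2; lra.
Qed.

End Bernoulli.

Section Sector.
Variable R : realType.
Local Notation C := (Rcomplex R).
Local Notation nrm x := (`|(x : C)|).
Local Notation Re := (@complex.Re R).
Local Notation Im := (@complex.Im R).
Implicit Types x y z s : C.

(* The half-angle arctan(8/5) of this sector is smaller than pi/3, so its image
   under the cube map omits the sector around the negative axis that is cut out
   by [cube_cone]; 88/835 = (3k - k^3) / (3k^2 - 1) for k = 8/5. *)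
Definition sector x := `|Im x| <= 8 / 5 * Re x.
Definition cube_cone s := 0 <= 88 * Re s + 835 * `|Im s|.

Lemma sector_Re x : sector x -> 0 <= Re x.
Proof. by rewrite /sector => h; have := normr_ge0 (Im x); lra. Qed.

Lemma sector_norm x : sector x -> nrm x <= 2 * Re x.
Proof.
move=> h; have p0 := sector_Re h.
rewrite -(@ler_pXn2r _ 2) ?nnegrE ?normr_ge0 ?mulr_ge0 // Rcnorm_sqr.
have : `|Im x| ^+ 2 <= (8 / 5 * Re x) ^+ 2.
  by rewrite ler_pXn2r ?nnegrE ?normr_ge0 // mulr_ge0.
rewrite real_normK ?num_real //; nra.
Qed.

Lemma Re_cube x : Re (x ^+ 3) = Re x ^+ 3 - 3 * (Re x * `|Im x| ^+ 2).
Proof. rewrite real_normK ?num_real // !exprS expr0 mulr1 !ReImE; ring. Qed.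

(** Since 17/10 < [sqrt 3], the factor [3 Re^2 - Im^2] of the imaginary part is nonnegative. *)
Lemma norm_Im_cube x : `|Im x| <= 17 / 10 * Re x ->
  `|Im (x ^+ 3)| = 3 * (Re x ^+ 2 * `|Im x|) - `|Im x| ^+ 3.
Proof.
move=> h; have -> : Im (x ^+ 3) = Im x * (3 * Re x ^+ 2 - `|Im x| ^+ 2).
  by rewrite real_normK ?num_real // !exprS expr0 mulr1 !ReImE; ring.
rewrite normrM [X in _ * X]ger0_norm; first by ring.
have := normr_ge0 (Im x); nra.
Qed.

(** The coefficients 88 and 835 make the cubic form divisible by the linear form that defines
    [sector]. The quadratic cofactor has positive coefficients, so the sign is decided by the linear
    factor. *)
Lemma cube_cone_factor x : `|Im x| <= 17 / 10 * Re x ->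
  88 * Re (x ^+ 3) + 835 * `|Im (x ^+ 3)| = (8 * Re x - 5 * `|Im x|) *
    (11 * Re x ^+ 2 + 320 * (Re x * `|Im x|) + 167 * `|Im x| ^+ 2).
Proof. by move=> h; rewrite norm_Im_cube // Re_cube; ring. Qed.

Lemma sector_cube x : sector x -> cube_cone (x ^+ 3).
Proof.
move=> h; have p0 := sector_Re h; rewrite /sector in h.
have h' : `|Im x| <= 17 / 10 * Re x by lra.
have q0 := normr_ge0 (Im x).
rewrite /cube_cone (cube_cone_factor h') mulr_ge0; [by []|by lra|].
have := mulr_ge0 p0 q0; have := exprn_ge0 2 p0; have := exprn_ge0 2 q0; lra.
Qed.

(** This restores slope 8/5 from slope 17/10 once the cube is known to lie in the cone. Thus errors
    do not accumulate when a root is corrected many times. *)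
Lemma sector_of_cube x : `|Im x| <= 17 / 10 * Re x -> cube_cone (x ^+ 3) ->
  sector x.
Proof.
move=> h; rewrite /cube_cone (cube_cone_factor h) /sector => F.
have q0 := normr_ge0 (Im x).
have [p0|p0] := ltP 0 (Re x); last by lra.
have g0 : 0 < 11 * Re x ^+ 2 + 320 * (Re x * `|Im x|) + 167 * `|Im x| ^+ 2.
  have := mulr_ge0 (ltW p0) q0; have := exprn_gt0 2 p0.
  by have := exprn_ge0 2 q0; lra.
by move: F; rewrite pmulr_lge0 //; lra.
Qed.

(** The point [- K] lies on the omitted axis, at a distance from the cone proportional to [K]; 923 =
    88 + 835. *)
Lemma cube_cone_norm s (K : R) : cube_cone s -> 0 <= K ->
  88 * K <= 923 * nrm (s + K *: 1).
Proof.
rewrite /cube_cone => h K0.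
have := Re_le_norm (s + K *: 1); have := Im_le_norm (s + K *: 1).
rewrite !ReImE /= mulr0 addr0 mulr1 => h1 h2.
have := ler_norm (Re s + K); lra.
Qed.

Lemma cube_coneD s (K : R) : cube_cone s -> 0 <= K -> cube_cone (s + K *: 1).
Proof. by rewrite /cube_cone !ReImE /= mulr0 addr0 mulr1 => ? ?; lra. Qed.

Lemma inv_Re_Im x y : x * y = 1 ->
  Re y = nrm y ^+ 2 * Re x /\ Im y = - (nrm y ^+ 2 * Im x).
Proof.
move=> h; have h1 : Re x * Re y - Im x * Im y = 1 by rewrite -ReM h.
have h2 : Re x * Im y + Im x * Re y = 0 by rewrite -ImM h.
rewrite Rcnorm_sqr; split.
  rewrite -[LHS]mulr1 -h1.
  transitivity (Re y ^+ 2 * Re x - Im y * (Im x * Re y)); first by ring.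
  have -> : Im x * Re y = - (Re x * Im y) by lra.
  by ring.
rewrite -[LHS]mulr1 -h1.
transitivity (Re y * (Re x * Im y) - Im y ^+ 2 * Im x); first by ring.
have -> : Re x * Im y = - (Im x * Re y) by lra.
by ring.
Qed.

Lemma sector_inv x y : x * y = 1 -> sector x -> sector y.
Proof.
move=> /inv_Re_Im[h1 h2]; rewrite /sector h2 h1 normrN normrM => h.
rewrite [`|_ ^+ 2|]ger0_norm ?exprn_ge0 // mulrCA.
by rewrite ler_wpM2l // exprn_ge0.
Qed.

Lemma cube_cone_inv x y : x * y = 1 -> cube_cone x -> cube_cone y.
Proof.
move=> /inv_Re_Im[h1 h2]; rewrite /cube_cone h2 h1 normrN normrM => h.
have N0 : 0 <= nrm y ^+ 2 by exact: exprn_ge0.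
rewrite (ger0_norm N0); have := mulr_ge0 N0 h; lra.
Qed.

(** As [|x| <= 2 Re x], both coordinates move by at most [Re x / 30], and (8/5 + 1/30) / (1 - 1/30)
    < 17/10. *)
Lemma sector_perturb x y : sector x -> nrm (y - x) <= nrm x / 60 ->
  `|Im y| <= 17 / 10 * Re y.
Proof.
move=> h hy; have p0 := sector_Re h; have := sector_norm h.
have := Re_le_norm (y - x); have := Im_le_norm (y - x).
rewrite !ReImE => h1 h2 h3.
move: h h1 h2; rewrite /sector !ler_norml => /andP[? ?] /andP[? ?] /andP[? ?].
by apply/andP; split; lra.
Qed.

(** A quantitative form of the injectivity of the cube map on the sector: the factors of [x^3 - y^3]
    other than [x - y] are bounded below by [|x - y| / 40], and 1600 is the square of 40. *)
Lemma sector_cube_dist x y : sector x -> sector y ->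
  nrm (x - y) ^+ 3 <= 1600 * nrm (x ^+ 3 - y ^+ 3).
Proof.
move=> hx hy; have x0 := sector_Re hx; have y0 := sector_Re hy.
have nx := sector_norm hx; have ny := sector_norm hy.
pose c : R := Num.sqrt 3; have c2 : c ^+ 2 = 3 by rewrite sqr_sqrtr.
have c0 : 0 <= c by exact: sqrtr_ge0.
have c17 : 17 / 10 <= c.
  by rewrite -(@ler_pXn2r _ 2) ?nnegrE // c2; lra.
(* The coefficients of [y] are exp(i pi/3) and exp(-i pi/3), so [x^3 - y^3 = (x - y) A B]. *)
pose A := x + (2^-1 +i* (c / 2))%C * y; pose B := x + (2^-1 +i* (- (c / 2)))%C * y.
(* In [A] the two terms have arguments in an interval centred at pi/6 and shorter than pi. Rotation
   by -pi/6 makes both real parts nonnegative, so they cannot cancel; [B] is symmetric. *)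
have key (D w : C) : nrm w = 1 -> (Re x + Re y) / 20 <= Re (D * w) ->
    nrm (x - y) <= 40 * nrm D.
  move=> w1 h; have := Re_le_norm (D * w); rewrite RcnormM w1 mulr1.
  have := ler_norm (Re (D * w)); have := ler_normB x y; lra.
have cxy : 17 / 10 * (Re x + Re y) <= c * (Re x + Re y).
  by rewrite ler_wpM2r // addr_ge0.
move: (hx) (hy); rewrite /sector !ler_norml => /andP[hx1 hx2] /andP[hy1 hy2].
have hA : nrm (x - y) <= 40 * nrm A.
  apply: (key _ ((c / 2) -i* 2^-1)%C).
    by rewrite RcnormE /= -[RHS]sqrtr1; congr Num.sqrt; rewrite sqrrN; lra.
  have -> : Re (A * ((c / 2) -i* 2^-1)%C) =
      (c * (Re x + Re y) + Im x - (c ^+ 2 - 1) / 2 * Im y) / 2.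
    by rewrite !ReImE /=; field.
  by rewrite c2; lra.
have hB : nrm (x - y) <= 40 * nrm B.
  apply: (key _ ((c / 2) +i* 2^-1)%C).
    by rewrite RcnormE /= -[RHS]sqrtr1; congr Num.sqrt; lra.
  have -> : Re (B * ((c / 2) +i* 2^-1)%C) =
      (c * (Re x + Re y) - Im x + (c ^+ 2 - 1) / 2 * Im y) / 2.
    by rewrite !ReImE /=; field.
  by rewrite c2; lra.
have -> : x ^+ 3 - y ^+ 3 = (x - y) * (A * B).
  have -> : A * B = x ^+ 2 + x * y + y ^+ 2.
    have -> : A * B = x ^+ 2 + x * y + (4^-1 + (c / 2) ^+ 2) *: y ^+ 2.
      by apply: ReIm_inj; rewrite !expr2 !ReImE /=; field.
    by rewrite expr_div_n c2 (_ : 4^-1 + _ = 1) ?scale1r //; field.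
  by ring.
rewrite !RcnormM.
have -> : 1600 * (nrm (x - y) * (nrm A * nrm B)) =
    nrm (x - y) * ((40 * nrm A) * (40 * nrm B)) by ring.
by rewrite exprS expr2; apply: ler_wpM2l => //; exact: ler_pM.
Qed.

End Sector.

(** * Uniform limits of polynomials *)

Section UniformClosure.
Variable R : realType.
Local Notation C := (Rcomplex R).
Local Notation nrm x := (`|(x : C)|).
Implicit Types (D : set (C2 R)) (f g : C2 R -> C) (p : {poly {poly C}}) (z : C2 R).

Lemma eval2D p p' z : eval2 (p + p') z = eval2 p z + eval2 p' z.
Proof. by rewrite /eval2 !hornerD. Qed.

Lemma eval2M p p' z : eval2 (p * p') z = eval2 p z * eval2 p' z.
Proof. by rewrite /eval2 !hornerM. Qed.

Lemma eval2C (c : C) z : eval2 c%:P%:P z = c.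
Proof. by rewrite /eval2 !hornerC. Qed.

Lemma eval2X z : eval2 'X z = z.1.
Proof. by rewrite /eval2 hornerX hornerC. Qed.

Lemma eval2Y z : eval2 ('X : {poly C})%:P z = z.2.
Proof. by rewrite /eval2 hornerC hornerX. Qed.

(** Boundedness is included because products of uniform limits require it. *)
Definition poly_approx D g :=
  (exists M : R, forall q, D q -> nrm (g q) <= M) /\
  forall e : R, 0 < e -> exists p, forall q, D q -> nrm (eval2 p q - g q) <= e.

Lemma poly_approx_cst D (c : C) : poly_approx D (fun=> c).
Proof.
split; first by exists `|c|.
by move=> e e0; exists c%:P%:P => q _; rewrite eval2C subrr normr0 ltW.
Qed.

Lemma poly_approxD D f g : poly_approx D f -> poly_approx D g ->
  poly_approx D (fun q => f q + g q).
Proof.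
move=> [[M hM] hf] [[N hN] hg]; split.
  by exists (M + N) => q Dq; rewrite (le_trans (ler_normD _ _)) // lerD ?hM ?hN.
move=> e e0; have e2 : 0 < e / 2 by rewrite divr_gt0.
have [p hp] := hf _ e2; have [p' hp'] := hg _ e2; exists (p + p') => q Dq.
rewrite eval2D opprD addrACA (le_trans (ler_normD _ _)) //.
by have := hp _ Dq; have := hp' _ Dq; lra.
Qed.

Lemma poly_approxM D f g : poly_approx D f -> poly_approx D g ->
  poly_approx D (fun q => f q * g q).
Proof.
move=> [[M hM] hf] [[N hN] hg].
have M1 q : D q -> nrm (f q) <= `|M| + 1.
  by move=> Dq; have := hM _ Dq; have := ler_norm M; lra.
have N1 q : D q -> nrm (g q) <= `|N|.
  by move=> Dq; have := hN _ Dq; have := ler_norm N; lra.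
have a0 : 0 <= `|M| := normr_ge0 _; have b0 : 0 <= `|N| := normr_ge0 _.
split.
  exists ((`|M| + 1) * `|N|) => q Dq; rewrite RcnormM.
  by apply: ler_pM => //; [exact: M1|exact: N1].
move=> e e0; pose d := e / (`|M| + `|N| + 1 + e + 1).
have T0 : 0 < `|M| + `|N| + 1 + e + 1 by lra.
have d0 : 0 < d by rewrite divr_gt0.
have d1 : d <= e by rewrite ler_pdivrMr // ler_peMr // ?ltW //; lra.
have dE : d * (`|M| + `|N| + 1 + e + 1) = e by rewrite divfK // gt_eqF.
have [p hp] := hf _ d0; have [p' hp'] := hg _ d0; exists (p * p') => q Dq.
rewrite eval2M.
have -> : eval2 p q * eval2 p' q - f q * g q =
  (eval2 p q - f q) * ((eval2 p' q - g q) + g q) + f q * (eval2 p' q - g q).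
  by ring.
apply: le_trans (ler_normD _ _) _; rewrite !RcnormM.
have h1 : nrm (eval2 p q - f q) * nrm ((eval2 p' q - g q) + g q) <= d * (e + `|N|).
  apply: ler_pM => //; first exact: hp.
  by apply: le_trans (ler_normD _ _) _; have := hp' _ Dq; have := N1 _ Dq; lra.
have h2 : nrm (f q) * nrm (eval2 p' q - g q) <= (`|M| + 1) * d.
  by apply: ler_pM => //; [exact: M1|exact: hp'].
apply: le_trans (lerD h1 h2) _; rewrite -[leRHS]dE.
by have := ltW d0; lra.
Qed.

Lemma poly_approxX D f n : poly_approx D f -> poly_approx D (fun q => f q ^+ n).
Proof.
move=> hf; elim: n => [|n IH].
  by under eq_fun do rewrite expr0; exact: poly_approx_cst.
by under eq_fun do rewrite exprS; exact: poly_approxM.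
Qed.

Lemma poly_approxB D f g : poly_approx D f -> poly_approx D g ->
  poly_approx D (fun q => f q - g q).
Proof.
move=> hf hg; rewrite (_ : (fun q => _) = (fun q => f q + (-1) * g q)).
  by apply: poly_approxD => //; apply: poly_approxM => //; exact: poly_approx_cst.
by apply/funext => q; rewrite mulN1r.
Qed.

Lemma poly_approxZ D (a : R) f : poly_approx D f -> poly_approx D (fun q => a *: f q).
Proof.
move=> hf; rewrite (_ : (fun q => _) = (fun q => (a *: 1 : C) * f q)).
  by apply: poly_approxM => //; exact: poly_approx_cst.
by apply/funext => q; rewrite -scalerAl mul1r.
Qed.

Lemma poly_approx_eq D f g : (forall q, D q -> f q = g q) ->
  poly_approx D f -> poly_approx D g.
Proof.
move=> fg [[M hM] h]; split; first by exists M => q Dq; rewrite -fg // hM.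
by move=> e /h[p hp]; exists p => q Dq; rewrite -fg // hp.
Qed.

Lemma poly_approx_lim D f :
  (forall e : R, 0 < e -> exists2 g, poly_approx D g &
    forall q, D q -> nrm (g q - f q) <= e) ->
  poly_approx D f.
Proof.
move=> H; split.
  have [g [[M hM] _] hg] := H 1 ltr01; exists (M + 1) => q Dq.
  rewrite -[f q](subrK (g q)) addrC (le_trans (ler_normD _ _)) // lerD ?hM //.
  by rewrite distrC hg.
move=> e e0; have e2 : 0 < e / 2 by rewrite divr_gt0.
have [g [_ hg] gf] := H _ e2; have [p hp] := hg _ e2; exists p => q Dq.
rewrite -(subrKA (g q)) (le_trans (ler_normD _ _)) //.
by have := hp _ Dq; have := gf _ Dq; lra.
Qed.

Lemma poly_approx1 D (M : R) : (forall q, D q -> nrm q.1 <= M) ->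
  poly_approx D (fun q => q.1).
Proof.
move=> h; split; first by exists M.
by move=> e e0; exists 'X => q _; rewrite eval2X subrr normr0 ltW.
Qed.

Lemma poly_approx2 D (M : R) : (forall q, D q -> nrm q.2 <= M) ->
  poly_approx D (fun q => q.2).
Proof.
move=> h; split; first by exists M.
by move=> e e0; exists ('X : {poly C})%:P => q _; rewrite eval2Y subrr normr0 ltW.
Qed.

End UniformClosure.

(** * Cube roots as uniform limits of polynomials *)

Section CubeRoot.
Variable R : realType.
Local Notation C := (Rcomplex R).
Local Notation nrm x := (`|(x : C)|).
Local Notation Re := (@complex.Re R).
Local Notation Im := (@complex.Im R).
Implicit Types (D : set (C2 R)) (f g s : C2 R -> C).

Lemma pow_small (a q e : R) : 0 <= a -> 0 <= q < 1 -> 0 < e ->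
  exists n, a * q ^+ n <= e.
Proof.
move=> a0 /andP[q0 q1] e0.
have y0 : 0 < 1 - q by rewrite subr_gt0.
have T0 : 0 <= a / (e * (1 - q)) by rewrite divr_ge0 // mulr_ge0 // ltW.
have := truncnS_gt (a / (e * (1 - q))); set n := (Num.truncn _).+1 => hn.
exists n; have := @mul_pow_decay R (1 - q) n.
have -> : 1 - (1 - q) = q by ring.
have -> : 0 <= 1 - q <= 1 by apply/andP; split; lra.
move=> /(_ isT).
have n0 : 0 < n%:R :> R by rewrite ltr0n.
rewrite ltr_pdivrMr ?mulr_gt0 // in hn.
have Q0 : 0 <= q ^+ n by rewrite exprn_ge0.
move=> h; apply: le_trans (ler_wpM2r Q0 (ltW hn)) _.
have -> : n%:R * (e * (1 - q)) * q ^+ n = e * (n%:R * ((1 - q) * q ^+ n)) by ring.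
by rewrite -[leRHS]mulr1 ler_wpM2l // ltW.
Qed.

(** For [|y|] up to this radius, [|(1 - y)^-1 - 1| <= 2 |y| <= (1/60)^3], so [(1 - y)^-1] has a cube
    root within 1/60 of 1. The value 1/60 is the tolerance of [sector_perturb]. *)
Definition inv_cuberoot_radius : R := (1 / 60) ^+ 3 / 2.

Lemma inv_cuberoot_ex (y : C) : nrm y <= inv_cuberoot_radius ->
  exists2 v : C, v ^+ 3 * (1 - y) = 1 & nrm (v - 1) <= 1 / 60.
Proof.
move=> hy; have r1 : inv_cuberoot_radius <= 1 / 2 by rewrite /inv_cuberoot_radius; lra.
have y1 : 1 / 2 <= nrm (1 - y).
  by have := ler_normD (1 - y : C) y; rewrite subrK Rcnorm1; lra.
have y0 : 1 - y != 0 by rewrite -normr_gt0; lra.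
have [v v3 hv] := cuberoot_near (1 - y)^-1 1.
exists v; first by rewrite v3 mulVf.
rewrite -(@ler_pXn2r _ 3) ?nnegrE ?divr_ge0 //; apply: le_trans hv _.
have -> : (1 - y)^-1 - 1 ^+ 3 = y / (1 - y).
  by field.
rewrite RcnormM RcnormV ler_pdivrMr ?(lt_le_trans _ y1) //.
apply: le_trans hy _; rewrite /inv_cuberoot_radius ler_wpM2l // ?exprn_ge0 ?divr_ge0 //.
by rewrite -div1r.
Qed.

(** Newton's iteration for [(1 - y) v^3 = 1] with the derivative frozen at 3, its value at [v = 1],
    [y = 0]. No division by a variable occurs, so every iterate is a polynomial in [y]. *)
Fixpoint newton (n : nat) (y : C) : C :=
  if n is n'.+1 then
    newton n' y + 3^-1 * (1 - (1 - y) * newton n' y ^+ 3)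
  else 1.

Lemma newton_cvg (y v : C) n : nrm y <= inv_cuberoot_radius ->
  v ^+ 3 * (1 - y) = 1 -> nrm (v - 1) <= 1 / 60 ->
  nrm (newton n y - v) <= 1 / 60 * (1 / 2) ^+ n.
Proof.
move=> hy v3 hv; have r1 : nrm y <= 1 / 60.
  by apply: le_trans hy _; rewrite /inv_cuberoot_radius; lra.
elim: n => [|n IH]; first by rewrite expr0 mulr1 /= distrC.
set N := newton n y in IH *; rewrite [newton n.+1 y]/= -/N.
pose a := N - v; pose b := v - 1.
have ha : nrm a <= 1 / 60.
  by apply: le_trans IH _; rewrite ler_piMr // exprn_ile1 //; lra.
(* Defined by [N^3 - v^3 = 3 a (1 + q)]. The new error is then [a (1 - (1 - y) (1 + q))], and its
   factor is at most 2/60 + 4/60. *)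
pose q := a + 2 * b + 3^-1 * (a * a + 3 * (a * b) + 3 * (b * b)).
have bnd (x x' : C) : nrm x <= 1 / 60 -> nrm x' <= 1 / 60 ->
    nrm (x * x') <= 1 / 60 * (1 / 60).
  by move=> hx hx'; rewrite RcnormM; apply: ler_pM.
have hq : nrm q <= 4 / 60.
  apply: le_trans (ler_normD _ _) _.
  have h1 : nrm (a + 2 * b) <= 3 / 60.
    by apply: le_trans (ler_normD _ _) _; rewrite RcnormM Rcnorm_nat; lra.
  have h2 : nrm (a * a + 3 * (a * b) + 3 * (b * b)) <= 7 * (1 / 60 * (1 / 60)).
    apply: le_trans (ler_normD _ _) _.
    apply: le_trans (lerD (ler_normD _ _) (lexx _)) _.
    rewrite ![nrm (3 * _)]RcnormM !Rcnorm_nat.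
    by have := bnd _ _ ha ha; have := bnd _ _ ha hv; have := bnd _ _ hv hv; lra.
  rewrite RcnormM RcnormV Rcnorm_nat; lra.
have -> : N + 3^-1 * (1 - (1 - y) * N ^+ 3) - v = a * (y * (1 + q) - q).
  have n3 : (3 : C) != 0 by rewrite -normr_gt0 Rcnorm_nat.
  by rewrite -[X in X - (1 - y) * _]v3 /q /a /b; field.
rewrite RcnormM exprS mulrCA mulrC; apply: ler_pM => //.
apply: le_trans (ler_normB _ _) _; rewrite RcnormM.
have h1q : nrm (1 + q) <= 2.
  by apply: le_trans (ler_normD _ _) _; rewrite Rcnorm1; lra.
have := ler_pM (normr_ge0 _) (normr_ge0 _) r1 h1q; lra.
Qed.

Lemma poly_approx_inv_cuberoot D g : poly_approx D g ->
  (forall q, D q -> nrm (g q) <= inv_cuberoot_radius) ->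
  exists2 v, poly_approx D v & forall q, D q ->
    v q ^+ 3 * (1 - g q) = 1 /\ nrm (v q - 1) <= 1 / 60.
Proof.
move=> hg bg.
have /choice[v hv] : forall q, exists v : C, D q ->
    v ^+ 3 * (1 - g q) = 1 /\ nrm (v - 1) <= 1 / 60.
  move=> q; have [Dq|nDq] := pselect (D q); last by exists 0.
  by have [v ? ?] := inv_cuberoot_ex (bg _ Dq); exists v.
exists v => //; apply: poly_approx_lim => e e0.
have [||n hn] := @pow_small (1 / 60) (1 / 2) e _ _ e0; [by lra|by lra|].
exists (fun q => newton n (g q)); last first.
  move=> q Dq; have [v3 v1] := hv _ Dq.
  by apply: le_trans hn; apply: newton_cvg => //; exact: bg.
elim: n {hn} => [|n IH] /=; first exact: poly_approx_cst.
apply: poly_approxD => //; apply: poly_approxM; first exact: poly_approx_cst.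
apply: poly_approxB.
  exact: poly_approx_cst.
apply: poly_approxM; last exact: poly_approxX.
by apply: poly_approxB => //; exact: poly_approx_cst.
Qed.

End CubeRoot.

Section CubeRootApprox.
Variable R : realType.
Local Notation C := (Rcomplex R).
Local Notation nrm x := (`|(x : C)|).
Local Notation Re := (@complex.Re R).
Local Notation Im := (@complex.Im R).
Local Notation rho := (inv_cuberoot_radius R).
Variables (D : set (C2 R)) (s : C2 R -> C).
Hypothesis sA : poly_approx D s.
Hypothesis s_cone : forall q, D q -> cube_cone (s q).

(** [H] is the branch of [(s + K)^(-1/3)] in the sector, and [- K] is the pole to be pushed along
    the negative axis towards 0. *)
Definition inv_cuberoot_shift (K : R) := exists2 H : C2 R -> C, poly_approx D H &
  forall q, D q -> sector (H q) /\ H q ^+ 3 * (s q + K *: 1) = 1.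

Lemma inv_cuberoot_radius_gt0 : 0 < rho.
Proof. by rewrite /inv_cuberoot_radius; lra. Qed.

Lemma inv_cuberoot_shift_large : exists2 K : R, 0 < K & inv_cuberoot_shift K.
Proof.
have [[M hM] _] := sA; have r0 := inv_cuberoot_radius_gt0.
(* For [K = L^3] large, [(s + K)^(-1/3) = L^-1 (1 + s / L^3)^(-1/3)], and this [L] brings [s / L^3]
   into the disc where the iteration converges. *)
pose L := `|M| / rho + 1.
have L1 : 1 <= L by rewrite /L lerDr divr_ge0 // ltW.
have L0 : 0 < L by exact: lt_le_trans L1.
have hML : M <= rho * L ^+ 3.
  apply: (@le_trans _ _ (rho * L)).
    by rewrite /L mulrDr mulrCA divff ?gt_eqF // !mulr1; have := ler_norm M; lra.
  by rewrite ler_pM2l // exprS ler_peMr ?(ltW L0) // exprn_ege1.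
exists (L ^+ 3); first exact: exprn_gt0.
have gA : poly_approx D (fun q => (- L ^- 3) *: s q) by exact: poly_approxZ.
have gB q : D q -> nrm ((- L ^- 3) *: s q) <= rho.
  move=> Dq; rewrite normrZ normrN ger0_norm ?invr_ge0 ?exprn_ge0 ?(ltW L0) //.
  by rewrite mulrC ler_pdivrMr ?exprn_gt0 //; apply: le_trans hML; exact: hM.
have [v vA hv] := poly_approx_inv_cuberoot gA gB.
exists (fun q => L^-1 *: v q); first exact: poly_approxZ.
move=> q Dq; have [v3 v1] := hv _ Dq; split.
  rewrite /sector !ReImE normrM ger0_norm ?invr_ge0 ?(ltW L0) // mulrCA.
  rewrite ler_wpM2l ?invr_ge0 ?(ltW L0) //.
  have := le_trans (Im_le_norm _) v1; have := le_trans (Re_le_norm _) v1.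
  rewrite !ReImE /= oppr0 addr0 !ler_norml => /andP[? ?] /andP[? ?].
  by apply/andP; split; lra.
have L3 : L ^+ 3 != 0 by rewrite expf_neq0 // gt_eqF.
rewrite -[RHS]v3 Rc_exprZ -scalerAl -Rc_mulrZ; congr (_ * _).
by rewrite scalerDr scalerA exprVn mulVf // scale1r scaleNr opprK addrC.
Qed.

(** Moving the pole by [d] multiplies [s + K] by [1 - d H^3]. By [cube_cone_norm], [|d H^3|] stays
    within the radius if [d] is this fixed fraction of [K]; hence [K] decreases geometrically. *)
Definition shift_ratio : R := 1 - 88 / 923 * rho.

Lemma inv_cuberoot_shift_step (K : R) : 0 < K -> inv_cuberoot_shift K ->
  inv_cuberoot_shift (K * shift_ratio).
Proof.
move=> K0 [H HA hH]; have r0 := inv_cuberoot_radius_gt0.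
pose d := 88 / 923 * rho * K; have d0 : 0 < d by have := mulr_gt0 r0 K0; rewrite /d; lra.
have gA : poly_approx D (fun q => d *: H q ^+ 3).
  by apply: poly_approxZ; exact: poly_approxX.
have gB q : D q -> nrm (d *: H q ^+ 3) <= rho.
  move=> Dq; have [_ H3] := hH _ Dq.
  have h := cube_cone_norm (s_cone Dq) (ltW K0).
  have : nrm (H q ^+ 3) * nrm (s q + K *: 1) = 1 by rewrite -RcnormM H3 Rcnorm1.
  rewrite normrZ (gtr0_norm d0).
  set A := nrm (H q ^+ 3); set B := nrm (s q + K *: 1) in h * => AB.
  have A0 : 0 <= A by exact: normr_ge0.
  have AK : A * (88 * K) <= 923.
    apply: le_trans (ler_wpM2l A0 h) _.
    have -> : A * (923 * B) = 923 * (A * B) by ring.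
    by rewrite AB mulr1; exact: lexx.
  have := ler_wpM2l (ltW r0) AK; rewrite /d; lra.
have [v vA hv] := poly_approx_inv_cuberoot gA gB.
exists (fun q => H q * v q); first exact: poly_approxM.
move=> q Dq; have [v3 v1] := hv _ Dq; have [Hs H3] := hH _ Dq.
have Kr : 0 <= K * shift_ratio.
  by apply: mulr_ge0; [exact: ltW|rewrite /shift_ratio /inv_cuberoot_radius; lra].
have E : (H q * v q) ^+ 3 * (s q + (K * shift_ratio) *: 1) = 1.
  have -> : (H q * v q) ^+ 3 * (s q + (K * shift_ratio) *: 1) =
      v q ^+ 3 * (H q ^+ 3 * (s q + K *: 1) - d *: H q ^+ 3).
    have -> : K * shift_ratio = K - d by rewrite /shift_ratio /d; ring.
    have -> : d *: (H q ^+ 3) = (d *: 1) * H q ^+ 3 by rewrite -scalerAl mul1r.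
    by rewrite scalerBl; ring.
  by rewrite H3 v3.
(* The correction factor may push the root slightly out of the sector. Its cube is the inverse of a
   point of the cone, so it lies in the cone, which brings the root back. *)
split => //; apply: sector_of_cube.
  apply: sector_perturb Hs _.
  rewrite -[X in _ - X]mulr1 -mulrBr RcnormM ler_wpM2l //.
  by apply: le_trans v1 _; lra.
apply: cube_cone_inv (cube_coneD (s_cone Dq) Kr).
by rewrite mulrC.
Qed.

Lemma inv_cuberoot_shift_small (e : R) : 0 < e ->
  exists K : R, [/\ 0 < K, K <= e & inv_cuberoot_shift K].
Proof.
move=> e0; have [K0 K00 hK] := inv_cuberoot_shift_large.
have q0 : 0 < shift_ratio by rewrite /shift_ratio /inv_cuberoot_radius; lra.
have q1 : shift_ratio < 1 by have := inv_cuberoot_radius_gt0; rewrite /shift_ratio; lra.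
have [|n hn] := @pow_small _ K0 shift_ratio e (ltW K00) _ e0.
  by rewrite (ltW q0).
exists (K0 * shift_ratio ^+ n); split => //; first by rewrite mulr_gt0 // exprn_gt0.
elim: n {hn} => [|n IH]; first by rewrite mulr1.
rewrite exprSr mulrA; apply: inv_cuberoot_shift_step => //.
by rewrite mulr_gt0 // exprn_gt0.
Qed.

End CubeRootApprox.

(** For [H = (phi^3 + K)^(-1/3)], the product [(phi^3 + K) H^2] is the inverse of [H], hence the
    root of [phi^3 + K] in the sector. By [sector_cube_dist] its distance from [phi] has cube at
    most [1600 K]. *)
Lemma poly_approx_cuberoot (R : realType) (D : set (C2 R)) (phi : C2 R -> Rcomplex R) :
  poly_approx D (fun q => phi q ^+ 3) -> (forall q, D q -> sector (phi q)) ->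
  poly_approx D phi.
Proof.
move=> sA hs; apply: poly_approx_lim => e e0.
have cone q : D q -> cube_cone (phi q ^+ 3) by move=> Dq; apply: sector_cube; exact: hs.
have [|K [K0 Ke [H HA hH]]] := inv_cuberoot_shift_small sA cone (e := e ^+ 3 / 1600).
  by have := exprn_gt0 3 e0; lra.
exists (fun q => (phi q ^+ 3 + K *: 1) * H q ^+ 2).
  apply: poly_approxM; last exact: poly_approxX.
  by apply: poly_approxD => //; exact: poly_approx_cst.
move=> q Dq; have [Hs H3] := hH _ Dq; set G := (X in X - _).
have HG : H q * G = 1 by rewrite -H3 /G; ring.
have G3 : G ^+ 3 = phi q ^+ 3 + K *: 1.
  have -> : G ^+ 3 = (phi q ^+ 3 + K *: 1) * (H q ^+ 3 * (phi q ^+ 3 + K *: 1)) ^+ 2.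
    by rewrite /G; ring.
  by rewrite H3 expr1n mulr1.
have := sector_cube_dist (sector_inv HG Hs) (hs _ Dq).
rewrite G3 addrAC subrr add0r normrZ Rcnorm1 mulr1 (gtr0_norm K0) => h.
rewrite -(@ler_pXn2r _ 3) ?nnegrE ?(ltW e0) //; apply: le_trans h _.
by lra.
Qed.

(** * Cube roots of W near z + t zbar *)

Section PerturbedPlane.
Variable R : realType.
Local Notation C := (Rcomplex R).
Local Notation nrm x := (`|(x : C)|).
Local Notation Re := (@complex.Re R).
Local Notation Im := (@complex.Im R).
Variables (t e1 delta : R) (F : C -> C).
Hypothesis t32 : 3 / 2 <= t ^+ 2.
Hypothesis t0 : 0 < t.
Hypothesis e1_gt0 : 0 < e1.
Hypothesis e1_le : 250 * (1 + t) ^+ 2 * e1 <= 1.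
Hypothesis delta1 : delta <= 1.
Hypothesis F0 : F 0 = 0.
Hypothesis F_lip : forall (rho : R) (z a : C), rho <= delta -> nrm z <= rho ->
  nrm a <= rho -> 3 * t * nrm (F z - F a) <= e1 ^+ 3 * rho ^+ 2 * nrm (z - a).

Definition plane_map (z : C) : C := z + t *: (conjc z : C).

(** A rational lower bound for [sqrt(3/2)]: the square of 61/50 is 1.4884. *)
Lemma t_ge : 61 / 50 <= t.
Proof.
rewrite leNgt; apply/negP => h; have : t * t <= 61 / 50 * (61 / 50) by (apply: ler_pM; have := t0; lra).
by move: t32; rewrite expr2; lra.
Qed.

Lemma e1_small : e1 <= 1 / 200.
Proof.
have := t_ge; move: e1_le e1_gt0 => h h0 ht.
have : 4 * e1 <= (1 + t) ^+ 2 * e1.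
  have : 2 * 2 <= (1 + t) * (1 + t) by apply: ler_pM; lra.
  by move=> h2; rewrite ler_wpM2r ?(ltW h0) // expr2; lra.
lra.
Qed.

Lemma plane_map_norm z : (t - 1) * nrm z <= nrm (plane_map z) <= (1 + t) * nrm z.
Proof.
have ht := t_ge; apply/andP; split; last first.
  apply: le_trans (ler_normD _ _) _.
  by rewrite normrZ RcnormJ (gtr0_norm t0); lra.
have := lerB_normD (t *: (conjc z : C)) z; rewrite normrZ RcnormJ (gtr0_norm t0).
by rewrite [_ + z]addrC /plane_map; lra.
Qed.

Lemma plane_mapB z a : plane_map z - plane_map a = plane_map (z - a).
Proof. by rewrite /plane_map raddfB scalerBr; ring. Qed.

Lemma p_tE z : (3 * t) *: p_t t z + z ^+ 3 = plane_map z ^+ 3.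
Proof.
by apply: ReIm_inj; rewrite /p_t /plane_map !exprS expr0 !ReImE /=; field.
Qed.

Lemma F_norm z : nrm z <= delta -> 3 * t * nrm (F z) <= (e1 * nrm z) ^+ 3.
Proof.
move=> hz; have := F_lip hz (lexx _) (_ : nrm (0 : C) <= nrm z).
rewrite normr0 F0 !subr0 => /(_ (normr_ge0 _)) h.
by have -> : (e1 * nrm z) ^+ 3 = e1 ^+ 3 * nrm z ^+ 2 * nrm z by ring.
Qed.

(** The factor [e1^3] in the bound on [F] becomes [e1] after the cube root. The values of [v] are
    chosen point by point; their dependence on [z] is controlled afterwards in [v_lip]. *)
Lemma plane_root : exists v : C -> C, forall z, nrm z <= delta ->
  v z ^+ 3 = plane_map z ^+ 3 + (3 * t) *: F z /\
  nrm (v z - plane_map z) <= e1 * nrm z.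
Proof.
have /choice[v hv] : forall z : C, exists v : C, nrm z <= delta ->
    v ^+ 3 = plane_map z ^+ 3 + (3 * t) *: F z /\
    nrm (v - plane_map z) <= e1 * nrm z.
  move=> z; have [v v3 h] := cuberoot_near (plane_map z ^+ 3 + (3 * t) *: F z) (plane_map z).
  exists v => hz; split=> //; rewrite -(@ler_pXn2r _ 3) ?nnegrE ?mulr_ge0 ?(ltW e1_gt0) //.
  apply: le_trans h _; rewrite addrC addKr normrZ ger0_norm ?F_norm //.
  by have := t0; lra.
by exists v.
Qed.

Variable v : C -> C.
Hypothesis v3 : forall z, nrm z <= delta ->
  v z ^+ 3 = plane_map z ^+ 3 + (3 * t) *: F z.
Hypothesis v_near : forall z, nrm z <= delta ->
  nrm (v z - plane_map z) <= e1 * nrm z.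

Lemma v_norm z : nrm z <= delta -> nrm (v z) <= (t + 2) * nrm z.
Proof.
move=> hz; have := v_near hz; have /andP[_] := plane_map_norm z.
have := ler_normD (v z - plane_map z) (plane_map z); rewrite subrK.
have : e1 * nrm z <= 1 * nrm z by rewrite ler_wpM2r //; have := e1_small; lra.
lra.
Qed.

Lemma sector_zv z : nrm z <= delta -> sector (z * v z).
Proof.
move=> hz; have ht := t_ge; have he := e1_small.
pose r := z * (v z - plane_map z); pose n := nrm z ^+ 2.
have hr : nrm r <= e1 * n.
  by rewrite /r RcnormM /n expr2 mulrCA ler_wpM2l // v_near.
have nE : n = Re z ^+ 2 + Im z ^+ 2 := Rcnorm_sqr z.
have n0 : 0 <= n by exact: exprn_ge0.
have -> : z * v z = z * plane_map z + r by rewrite /r; ring.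
have hRe : Re (z * plane_map z) = (1 + t) * Re z ^+ 2 + (t - 1) * Im z ^+ 2.
  by rewrite /plane_map !ReImE; ring.
have hIm : Im (z * plane_map z) = 2 * (Re z * Im z).
  by rewrite /plane_map !ReImE; ring.
have X0 := sqr_ge0 (Re z); have Y0 := sqr_ge0 (Im z).
pose A := (1 + t) * Re z ^+ 2 + (t - 1) * Im z ^+ 2.
have An : n / 5 <= A.
  rewrite nE /A.
  have := mulr_ge0 (_ : 0 <= 1 + t - 1 / 5) X0; have := mulr_ge0 (_ : 0 <= t - 1 - 1 / 5) Y0.
  by move=> /(_ ltac:(lra)) ? /(_ ltac:(lra)) ?; lra.
have A0 : 0 <= A by lra.
(* With [a] and [b] the two terms of [A], [(a + b)^2 = (a - b)^2 + 4 a b]; what remains carries the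
   factor [t^2 - 3/2]. *)
have hq : (2 * (Re z * Im z)) ^+ 2 <= 2 * A ^+ 2.
  have -> : 2 * A ^+ 2 = (2 * (Re z * Im z)) ^+ 2 +
    (2 * ((1 + t) * Re z ^+ 2 - (t - 1) * Im z ^+ 2) ^+ 2
     + 8 * (t ^+ 2 - 3 / 2) * (Re z ^+ 2 * Im z ^+ 2)) by rewrite /A; field.
  rewrite lerDl addr_ge0 //; first by rewrite mulr_ge0 // sqr_ge0.
  by apply: mulr_ge0; [have := t32; lra|exact: mulr_ge0].
have h15 : `|2 * (Re z * Im z)| <= 3 / 2 * A.
  rewrite -(@ler_pXn2r _ 2) ?nnegrE ?normr_ge0 ?mulr_ge0 //.
  rewrite real_normK ?num_real //; apply: le_trans hq _.
  by have := sqr_ge0 A; rewrite exprMn; lra.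
have h1 := le_trans (Re_le_norm r) hr; have h2 := le_trans (Im_le_norm r) hr.
(* The budget of the sector: 3/2 + (1 + 8/5) / 30 < 8/5. *)
have e5 : e1 * n <= A / 30.
  have : e1 * n <= 1 / 200 * n by rewrite ler_wpM2r.
  lra.
move: h1 h2 h15; rewrite /sector !ReD !ImD hRe hIm -/A.
rewrite !ler_norml => /andP[? ?] /andP[? ?] /andP[? ?].
by apply/andP; split; lra.
Qed.

(** Here [y] and [k] stand for [|v z|] and [|v z - v a|]: the sum [v z ^ 2 + v z * v a + v a ^ 2] is
    expanded around [3 v z ^ 2]. *)
Lemma quadratic_lower (rho k y : R) : 0 <= rho -> 0 <= k -> k <= rho / 20 ->
  rho / 5 <= y -> 2 / 25 * rho ^+ 2 <= 3 * y ^+ 2 - (3 * (y * k) + k ^+ 2).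
Proof.
move=> r0 k0 kr ry; have ky : k <= y / 4 by lra.
have h6 : y * k <= y * (y / 4) by rewrite ler_wpM2l //; lra.
have h7 : k * k <= y / 4 * (y / 4) by exact: ler_pM.
have h8 : rho / 5 * (rho / 5) <= y * y by apply: ler_pM => //; lra.
have := sqr_ge0 y; rewrite !expr2; lra.
Qed.

(* [v z - v a] times [v z ^ 2 + v z * v a + v a ^ 2] is a difference of cubes;
   the second factor is comparable to [rho ^ 2] when [z] and [a] are close. *)
Lemma v_lip_close (rho : R) z a : nrm z = rho -> nrm a <= rho -> rho <= delta ->
  40 * (1 + t) * nrm (z - a) <= rho ->
  nrm (v z - v a - (plane_map z - plane_map a)) <= nrm (z - a) / 2.
Proof.
move=> hz ha hd close; have ht := t_ge; have he := e1_small.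
have hz' : nrm z <= delta by rewrite hz.
have ha' : nrm a <= delta by exact: le_trans ha hd.
pose d := nrm (z - a); have d0 : 0 <= d by exact: normr_ge0.
have r0 : 0 <= rho by rewrite -hz.
set U := plane_map z; set V := plane_map a.
pose p := v z - U; pose q := v a - V.
have er0 : 0 <= e1 * rho by rewrite mulr_ge0 // ltW.
have hp : nrm p <= e1 * rho by rewrite -hz; exact: v_near.
have hq : nrm q <= e1 * rho.
  by apply: le_trans (v_near ha') _; rewrite ler_wpM2l // ltW.
have hU : nrm U <= (1 + t) * rho by have /andP[_] := plane_map_norm z; rewrite hz.
have t1 : 0 <= 1 + t by lra.
have hV : nrm V <= (1 + t) * rho.
  have /andP[_ h] := plane_map_norm a; apply: le_trans h _.
  by rewrite ler_wpM2l.
have hUV : nrm (U - V) <= (1 + t) * d.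
  by rewrite plane_mapB; have /andP[] := plane_map_norm (z - a).
have hF : 3 * t * nrm (F z - F a) <= e1 ^+ 3 * rho ^+ 2 * d.
  by apply: F_lip => //; rewrite hz.
pose S := v z ^+ 2 + v z * v a + v a ^+ 2.
(* [(v z - v a) S] is [U^3 - V^3] plus the difference of the [F] terms. Subtracting [(U - V) S]
   leaves [U^2 + U V + V^2 - S], in which every term contains [p] or [q] and is therefore of size
   [e1 rho^2]. *)
have E : (p - q) * S = - (U - V) * (p * (2 * U + p + V) + q * (U + p + 2 * V + q))
    + (3 * t) *: (F z - F a).
  have := v3 hz'; have := v3 ha'; rewrite -/U -/V => h1 h2.
  rewrite scalerBr -(addKr (V ^+ 3) ((3 * t) *: F a)) -h1.
  rewrite -(addKr (U ^+ 3) ((3 * t) *: F z)) -h2 /S.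
  have -> : v z = U + p by rewrite /p; ring.
  have -> : v a = V + q by rewrite /q; ring.
  by ring.
have rr0 : 0 <= rho ^+ 2 by exact: exprn_ge0.
have bnd (x y : C) : nrm x <= e1 * rho -> nrm y <= 4 * (1 + t) * rho ->
    nrm (x * y) <= 4 * (1 + t) * e1 * rho ^+ 2.
  move=> hx hy; rewrite RcnormM.
  have -> : 4 * (1 + t) * e1 * rho ^+ 2 = (e1 * rho) * (4 * (1 + t) * rho) by ring.
  exact: ler_pM.
have er : e1 * rho <= (1 + t) * rho / 2.
  have : e1 * rho <= 1 / 200 * rho by rewrite ler_wpM2r.
  have : 1 * rho <= (1 + t) * rho by rewrite ler_wpM2r //; lra.
  lra.
have B1 : nrm (p * (2 * U + p + V)) <= 4 * (1 + t) * e1 * rho ^+ 2.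
  apply: bnd => //; apply: le_trans (ler_normD _ _) _.
  apply: le_trans (lerD (ler_normD _ _) (lexx _)) _.
  by rewrite RcnormM Rcnorm_nat; lra.
have B2 : nrm (q * (U + p + 2 * V + q)) <= 4 * (1 + t) * e1 * rho ^+ 2.
  apply: bnd => //; apply: le_trans (ler_normD _ _) _.
  apply: le_trans (lerD (ler_normD _ _) (lexx _)) _.
  apply: le_trans (lerD (lerD (ler_normD _ _) (lexx _)) (lexx _)) _.
  by rewrite RcnormM Rcnorm_nat; lra.
have hE : nrm ((p - q) * S) <= 9 * (1 + t) ^+ 2 * e1 * rho ^+ 2 * d.
  rewrite E; apply: le_trans (ler_normD _ _) _.
  have h1 : nrm (- (U - V) * (p * (2 * U + p + V) + q * (U + p + 2 * V + q))) <=
      ((1 + t) * d) * (8 * (1 + t) * e1 * rho ^+ 2).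
    rewrite RcnormM normrN; apply: ler_pM => //.
    by apply: le_trans (ler_normD _ _) _; lra.
  have h2 : nrm ((3 * t) *: (F z - F a)) <= e1 ^+ 3 * rho ^+ 2 * d.
    by rewrite normrZ ger0_norm //; lra.
  have h3 : e1 ^+ 3 * (rho ^+ 2 * d) <= (1 + t) ^+ 2 * e1 * (rho ^+ 2 * d).
    apply: ler_wpM2r; first exact: mulr_ge0.
    have h4 : e1 ^+ 2 <= 1 by rewrite exprn_ile1 //; [exact: ltW|lra].
    have h5 : 1 <= (1 + t) ^+ 2 by rewrite exprn_ege1 //; lra.
    by rewrite exprSr ler_wpM2r ?(ltW e1_gt0) //; exact: le_trans h4 h5.
  apply: le_trans (lerD h1 h2) _; lra.
have vz : rho / 5 <= nrm (v z).
  have /andP[h _] := plane_map_norm z.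
  have := ler_normD (v z) (- p); rewrite normrN (_ : v z - p = U); last by rewrite /p; ring.
  have : e1 * rho <= 1 / 200 * rho by rewrite ler_wpM2r.
  have : (61 / 50 - 1) * rho <= (t - 1) * rho by rewrite ler_wpM2r //; lra.
  by move: h; rewrite hz -/U; lra.
have vd : nrm (v z - v a) <= rho / 20.
  have -> : v z - v a = (U - V) + p - q by rewrite /p /q; ring.
  apply: le_trans (ler_normB _ _) _; apply: le_trans (lerD (ler_normD _ _) (lexx _)) _.
  have : e1 * rho <= 1 / 200 * rho by rewrite ler_wpM2r.
  by move: close; rewrite -/d; lra.
have hS : 2 / 25 * rho ^+ 2 <= nrm S.
  set y := nrm (v z) in vz; set k := nrm (v z - v a) in vd.
  have -> : S = 3 * v z ^+ 2 - (3 * (v z * (v z - v a)) - (v z - v a) ^+ 2).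
    by rewrite /S; ring.
  have h1 := lerB_dist (3 * v z ^+ 2 : C) (3 * (v z * (v z - v a)) - (v z - v a) ^+ 2).
  apply: le_trans h1.
  have h2 := ler_normB (3 * (v z * (v z - v a)) : C) ((v z - v a) ^+ 2).
  have h3 : nrm (3 * (v z * (v z - v a))) = 3 * (y * k).
    by rewrite !RcnormM Rcnorm_nat.
  have h4 : nrm ((v z - v a) ^+ 2) = k ^+ 2 by rewrite RcnormX.
  have h5 : nrm (3 * v z ^+ 2) = 3 * y ^+ 2 by rewrite RcnormM Rcnorm_nat RcnormX.
  have k0 : 0 <= k by exact: normr_ge0.
  apply: le_trans (quadratic_lower r0 k0 vd vz) _.
  by rewrite h5 lerD2l lerN2 -h3 -h4.
have -> : v z - v a - (U - V) = p - q by rewrite /p /q; ring.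
have [r00|rpos] := eqVneq rho 0.
  move: hp hq; rewrite r00 mulr0 => hp hq.
  by apply: le_trans (ler_normB _ _) _; rewrite -/d; lra.
have r2 : 0 < rho ^+ 2 by rewrite exprn_gt0 // lt_neqAle eq_sym rpos.
move: hE; rewrite RcnormM => hE.
have := ler_wpM2l (normr_ge0 (p - q : C)) hS => hS'.
(* Divided by the lower bound 2/25 for [S], 9/250 gives 9/20 < 1/2; this is what the 250 in [e1_le]
   is for. *)
have h9 : (9 * (1 + t) ^+ 2 * e1) * (rho ^+ 2 * d) <= 9 / 250 * (rho ^+ 2 * d).
  by apply: ler_wpM2r; [exact: mulr_ge0|have := e1_le; lra].
have h10 := mulr_ge0 (ltW r2) d0.
by rewrite -(ler_pM2r r2) -/d; lra.
Qed.

(** For points far apart relative to the larger modulus, [v_near] at each of them suffices, as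
    [2 e1 |x| <= 80 (1 + t) e1 |x - y|]. Close points are left to [v_lip_close]. *)
Lemma v_lip z a : nrm z <= delta -> nrm a <= delta ->
  nrm (v z - v a - (plane_map z - plane_map a)) <= nrm (z - a) / 2.
Proof.
have far x y : nrm x <= delta -> nrm y <= nrm x ->
    nrm (v x - v y - (plane_map x - plane_map y)) <= nrm (x - y) / 2.
  move=> hx hy; have [h|h] := leP (40 * (1 + t) * nrm (x - y)) (nrm x).
    exact: v_lip_close (erefl _) hy hx h.
  have -> : v x - v y - (plane_map x - plane_map y) =
    (v x - plane_map x) - (v y - plane_map y) by ring.
  apply: le_trans (ler_normB _ _) _.
  have h1 := v_near hx; have h2 := v_near (le_trans hy hx).
  have h3 : e1 * nrm y <= e1 * nrm x by rewrite ler_wpM2l // ltW.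
  have h4 : 2 * e1 * nrm x <= 2 * e1 * (40 * (1 + t) * nrm (x - y)).
    by rewrite ler_wpM2l ?(ltW h) // mulr_ge0 // ltW.
  have h5 : (250 * (1 + t) * e1) * nrm (x - y) <= 1 * nrm (x - y).
    apply: ler_wpM2r; first exact: normr_ge0.
    apply: le_trans e1_le.
    rewrite ler_wpM2r ?(ltW e1_gt0) //.
    have : (1 + t) * 1 <= (1 + t) * (1 + t) by rewrite ler_wpM2l //; have := t0; lra.
    by rewrite expr2; lra.
  by have := normr_ge0 (x - y : C); lra.
move=> hz ha; have [h|/ltW h] := leP (nrm a) (nrm z); first exact: far.
have -> : v z - v a - (plane_map z - plane_map a) =
  - (v a - v z - (plane_map a - plane_map z)) by ring.
by rewrite normrN (distrC z); exact: far.
Qed.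

End PerturbedPlane.

(** * Polynomial hulls *)

Section Hull.
Variable R : realType.
Local Notation C := (Rcomplex R).
Local Notation nrm x := (`|(x : C)|).
Local Notation Re := (@complex.Re R).
Local Notation Im := (@complex.Im R).
Variables (K : set (C2 R)) (q0 : C2 R).

(* [q0] lies in the polynomial hull of [K], with an upper bound of [|p|] on [K]
   in place of its supremum. *)
Hypothesis hull : forall (p : {poly {poly C}}) (M : R),
  (forall q, K q -> nrm (eval2 p q) <= M) -> nrm (eval2 p q0) <= M.

Local Notation K0 := (K `|` [set q0]).

Lemma hull_approx (g : C2 R -> C) (M : R) : poly_approx K0 g ->
  (forall q, K q -> nrm (g q) <= M) -> nrm (g q0) <= M.
Proof.
move=> [_ hg] hM; apply/ler_addgt0Pr => e e0.
have e2 : 0 < e / 2 by lra.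
have [p hp] := hg _ e2.
have h1 : nrm (eval2 p q0) <= M + e / 2.
  apply: hull => q Kq; have := hp q (or_introl Kq); have := hM _ Kq.
  by have := ler_normD (eval2 p q - g q) (g q); rewrite subrK; lra.
have := hp q0 (or_intror erefl); have := ler_normD (g q0 - eval2 p q0) (eval2 p q0).
by rewrite subrK distrC; lra.
Qed.

(* A function [g] that vanishes to first order at a peak point of [1 - h]
   vanishes at [q0] as soon as [h] does. *)
Lemma hull_peak (g h : C2 R -> C) (B : R) : 0 <= B ->
  (forall n, poly_approx K0 (fun q => g q * (1 - h q) ^+ n)) -> h q0 = 0 ->
  (forall q, K q -> exists y, [/\ 0 <= y <= 1, nrm (g q) ^+ 2 <= B * y &
    nrm (1 - h q) ^+ 2 <= 1 - y]) -> g q0 = 0.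
Proof.
move=> B0 hA h0 hy; apply/eqP; rewrite -normr_le0 -(@ler_pXn2r _ 2) ?nnegrE //.
rewrite expr0n /=; apply/ler_addgt0Pr => e e0; rewrite add0r.
have T0 : 0 <= B / e by rewrite divr_ge0 // ltW.
(* By [mul_pow_decay], [B y (1 - y)^n <= B / n], which is at most [e] for this [n]. *)
have := truncnS_gt (B / e); set n := (Num.truncn _).+1; rewrite ltr_pdivrMr // => hn.
have n0 : 0 < n%:R :> R by rewrite ltr0n.
have bnd q : K q -> nrm (g q * (1 - h q) ^+ n) <= Num.sqrt e.
  move=> Kq; have [y [y01 hg hh]] := hy _ Kq.
  rewrite -(@ler_pXn2r _ 2) ?nnegrE ?sqrtr_ge0 // sqr_sqrtr ?(ltW e0) //.
  rewrite RcnormM RcnormX exprMn exprAC.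
  apply: (@le_trans _ _ (B * y * (1 - y) ^+ n)).
    apply: ler_pM => //; rewrite ?exprn_ge0 //.
    by apply: lerXn2r; rewrite ?nnegrE ?exprn_ge0 // (le_trans _ hh) ?exprn_ge0.
  have := mul_pow_decay n y01; rewrite -mulrA => hd.
  rewrite -(ler_pM2l n0) mulrCA; apply: le_trans (ler_wpM2l B0 hd) _.
  by rewrite mulr1 ltW.
have := hull_approx (hA n) bnd; rewrite h0 subr0 expr1n mulr1 => h1.
have := ler_pM (normr_ge0 _) (normr_ge0 _) h1 h1.
by rewrite -expr2 -[X in _ <= X]expr2 sqr_sqrtr // ltW.
Qed.

(** If no root of [x^3 = P(q0)] were a limit, an approximant [p] close to [f] on [K] would stay
    farther than some [e] from all three roots at [q0]. Then [|p^3 - P| > e^3] at [q0] while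
    [|p^3 - P| <= e^3] on [K], against the hull property. *)
Lemma hull_cuberoot (f : C2 R -> C) (P : {poly {poly C}}) : poly_approx K f ->
  (forall q, K q -> f q ^+ 3 = eval2 P q) ->
  exists2 x : C, x ^+ 3 = eval2 P q0 &
    forall e : R, 0 < e -> exists2 p : {poly {poly C}},
      (forall q, K q -> nrm (eval2 p q - f q) <= e) & nrm (eval2 p q0 - x) <= e.
Proof.
move=> [[M hM] fA] f3.
pose good (x : C) := forall e : R, 0 < e -> exists2 p : {poly {poly C}},
  (forall q, K q -> nrm (eval2 p q - f q) <= e) & nrm (eval2 p q0 - x) <= e.
have [a [b [d abd]]] := cuberoots (eval2 P q0).
have root x : (x - a) * (x - b) * (x - d) = 0 -> x ^+ 3 = eval2 P q0.
  by rewrite -abd => /eqP; rewrite subr_eq0 => /eqP.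
have [ga|na] := pselect (good a); first by exists a => //; apply: root; ring.
have [gb|nb] := pselect (good b); first by exists b => //; apply: root; ring.
have [gd|nd] := pselect (good d); first by exists d => //; apply: root; ring.
exfalso.
have bad x : ~ good x -> exists2 e : R, 0 < e & forall p : {poly {poly C}},
    (forall q, K q -> nrm (eval2 p q - f q) <= e) -> e < nrm (eval2 p q0 - x).
  move=> nx; apply: contrapT => h; apply: nx => e e0.
  apply: contrapT => h'; apply: h; exists e => // p hp.
  by rewrite ltNge; apply/negP => hx; apply: h'; exists p.
have [ea ea0 ha] := bad _ na; have [eb eb0 hb] := bad _ nb.
have [ed ed0 hd] := bad _ nd.
pose e := Num.min 1 (Num.min ea (Num.min eb ed)).
have e0 : 0 < e by rewrite !lt_min ltr01 ea0 eb0 ed0.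
have e1 : e <= 1 by rewrite ge_min lexx.
have eea : e <= ea by rewrite !ge_min lexx ?orbT.
have eeb : e <= eb by rewrite !ge_min lexx ?orbT.
have eed : e <= ed by rewrite !ge_min lexx ?orbT.
(* A bound on [K] for [p^2 + p f + f^2], the cofactor of [p - f] in [p^3 - f^3]. *)
pose T := 3 * (`|M| + 1) ^+ 2.
have M1 : 1 <= `|M| + 1 by rewrite lerDr.
have M2 : 1 <= (`|M| + 1) ^+ 2 by rewrite exprn_ege1.
have T0 : 0 < T by rewrite /T; lra.
pose eta := e ^+ 3 / T.
have e3 : 0 < e ^+ 3 by rewrite exprn_gt0.
have eta0 : 0 < eta by rewrite divr_gt0.
have etaT : eta * T = e ^+ 3 by rewrite divfK // gt_eqF.
have etae : eta <= e.
  rewrite ler_pdivrMr // exprSr [e * T]mulrC ler_wpM2r ?(ltW e0) //.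
  apply: (@le_trans _ _ 1); first by rewrite exprn_ile1 // ltW.
  by rewrite /T; lra.
have [p hp] := fA _ eta0.
have hpe q x : K q -> e <= x -> nrm (eval2 p q - f q) <= x.
  by move=> Kq ex; apply: le_trans (hp _ Kq) (le_trans etae ex).
have H : nrm (eval2 (p * p * p - P) q0) <= e ^+ 3.
  apply: hull => q Kq.
  have -> : eval2 (p * p * p - P) q = eval2 p q ^+ 3 - f q ^+ 3.
    by rewrite f3 // /eval2 !(hornerD, hornerN, hornerM); ring.
  have -> : eval2 p q ^+ 3 - f q ^+ 3 = (eval2 p q - f q) *
    (eval2 p q * eval2 p q + eval2 p q * f q + f q * f q) by ring.
  rewrite RcnormM -etaT; apply: ler_pM => //; first exact: hp.
  have hf : nrm (f q) <= `|M| + 1.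
    by apply: le_trans (hM _ Kq) _; have := ler_norm M; lra.
  have hp1 : nrm (eval2 p q) <= `|M| + 1.
    have := ler_normD (eval2 p q - f q) (f q); rewrite subrK.
    by have := hpe _ _ Kq e1; have := hM _ Kq; have := ler_norm M; lra.
  have bb (x y : C) : nrm x <= `|M| + 1 -> nrm y <= `|M| + 1 ->
      nrm (x * y) <= (`|M| + 1) ^+ 2.
    by move=> hx hy; rewrite RcnormM expr2; apply: ler_pM.
  apply: le_trans (ler_normD _ _) _.
  apply: le_trans (lerD (ler_normD _ _) (lexx _)) _.
  have := bb _ _ hp1 hp1; have := bb _ _ hp1 hf; have := bb _ _ hf hf.
  by rewrite /T; lra.
have ha' := ha p (fun q Kq => hpe q _ Kq eea).
have hb' := hb p (fun q Kq => hpe q _ Kq eeb).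
have hd' := hd p (fun q Kq => hpe q _ Kq eed).
have : e ^+ 3 < nrm (eval2 (p * p * p - P) q0).
  have -> : eval2 (p * p * p - P) q0 =
      (eval2 p q0 - a) * (eval2 p q0 - b) * (eval2 p q0 - d).
    by rewrite -abd /eval2 !(hornerD, hornerN, hornerM); ring.
  rewrite !RcnormM !exprS expr0 mulr1 mulrA.
  apply: ltr_pM; rewrite ?mulr_ge0 ?(ltW e0) //; last exact: le_lt_trans eed hd'.
  apply: ltr_pM; rewrite ?(ltW e0) //; first exact: le_lt_trans eea ha'.
  exact: le_lt_trans eeb hb'.
by rewrite ltNge H.
Qed.

End Hull.

(** * The hull adds no point to the graph *)

Section GraphHull.
Variable R : realType.
Local Notation C := (Rcomplex R).
Local Notation nrm x := (`|(x : C)|).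
Local Notation Re := (@complex.Re R).
Local Notation Im := (@complex.Im R).

Lemma poly_approx_sub (D D' : set (C2 R)) (g : C2 R -> C) :
  (forall q, D' q -> D q) -> poly_approx D g -> poly_approx D' g.
Proof.
move=> DD [[M hM] h]; split; first by exists M => q /DD; exact: hM.
by move=> e /h[p hp]; exists p => q /DD; exact: hp.
Qed.

Lemma norm_1B_scale (l : R) (h : C) :
  nrm (1 - l *: h) ^+ 2 = 1 - 2 * l * Re h + l ^+ 2 * nrm h ^+ 2.
Proof. by rewrite !Rcnorm_sqr !ReImE /=; ring. Qed.

Variables (t e1 delta : R) (F : C -> C).
Hypothesis t32 : 3 / 2 <= t ^+ 2.
Hypothesis t0 : 0 < t.
Hypothesis e1_gt0 : 0 < e1.
Hypothesis e1_le : 250 * (1 + t) ^+ 2 * e1 <= 1.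
Hypothesis delta1 : delta <= 1.
Hypothesis F0 : F 0 = 0.
Hypothesis F_lip : forall (rho : R) (z a : C), rho <= delta -> nrm z <= rho ->
  nrm a <= rho -> 3 * t * nrm (F z - F a) <= e1 ^+ 3 * rho ^+ 2 * nrm (z - a).
Variable v : C -> C.
Hypothesis v3 : forall z, nrm z <= delta ->
  v z ^+ 3 = plane_map t z ^+ 3 + (3 * t) *: F z.
Hypothesis v_near : forall z, nrm z <= delta ->
  nrm (v z - plane_map t z) <= e1 * nrm z.
Variables (K : set (C2 R)) (q0 : C2 R).
Hypothesis hull : forall (p : {poly {poly C}}) (M : R),
  (forall q, K q -> nrm (eval2 p q) <= M) -> nrm (eval2 p q0) <= M.
Hypothesis hK : forall q, K q -> nrm q.1 <= delta /\ q.2 = p_t t q.1 + F q.1.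
Hypothesis hq0 : nrm q0.1 <= delta.
Hypothesis q0K : ~ K q0.

Local Notation K0 := (K `|` [set q0]).
Local Notation v_norm := (v_norm t32 t0 e1_gt0 e1_le v_near).

Definition sheared (q : C2 R) : C := (3 * t) *: q.2 + q.1 ^+ 3.

Lemma sheared_v z : nrm z <= delta ->
  v z ^+ 3 = (3 * t) *: (p_t t z + F z) + z ^+ 3.
Proof. by move=> hz; rewrite v3 // -p_tE (scalerDr _ (p_t t z)) addrAC. Qed.

Lemma shearedE q : K q -> sheared q = v q.1 ^+ 3.
Proof. by move=> /hK[h E]; rewrite sheared_v // /sheared -E. Qed.

Lemma scale3t_inj (x y : C) : (3 * t) *: x = (3 * t) *: y -> x = y.
Proof. by apply: scalerI; rewrite mulf_neq0 ?pnatr_eq0 // gt_eqF. Qed.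

Lemma approx_fst : poly_approx K0 (fun q => q.1).
Proof. by apply: (poly_approx1 (M := delta)) => q [/hK[]|->]. Qed.

Lemma approx_snd : poly_approx K0 (fun q => q.2).
Proof.
have T0 : 0 < 3 * t by rewrite mulr_gt0.
apply: (poly_approx2 (M := ((t + 2) ^+ 3 + 1) / (3 * t) + nrm q0.2)) => q.
have B0 : 0 <= ((t + 2) ^+ 3 + 1) / (3 * t).
  by rewrite divr_ge0 ?(ltW T0) // addr_ge0 // exprn_ge0 // addr_ge0 // ltW.
move=> [Kq|->]; last by rewrite lerDr.
apply: (@le_trans _ _ (((t + 2) ^+ 3 + 1) / (3 * t))); last by rewrite lerDl.
rewrite ler_pdivlMr // mulrC -[X in X * _](gtr0_norm T0) -normrZ.
have [hz _] := hK Kq; have h1 : nrm q.1 <= 1 := le_trans hz delta1.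
have -> : (3 * t) *: q.2 = v q.1 ^+ 3 - q.1 ^+ 3 by rewrite -shearedE // /sheared addrK.
apply: le_trans (ler_normB _ _) _; rewrite !RcnormX lerD ?exprn_ile1 //.
rewrite ler_pXn2r ?nnegrE ?addr_ge0 ?(ltW t0) //.
by apply: le_trans (v_norm hz) _; rewrite ler_piMr // addr_ge0 // ltW.
Qed.

Lemma approx_sheared : poly_approx K0 sheared.
Proof.
apply: poly_approxD; last exact: poly_approxX approx_fst.
exact: poly_approxZ approx_snd.
Qed.

(** Assigns a value at [q0], which is not known to lie on the graph, so that its value there need
    not be the one given by [v]. *)
Definition extend (x : C) (f : C2 R -> C) (q : C2 R) : C :=
  if pselect (q = q0) then x else f q.

Lemma extend_q0 x f : extend x f q0 = x.
Proof. by rewrite /extend; case: pselect. Qed.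

Lemma extend_K x f q : K q -> extend x f q = f q.
Proof. by move=> Kq; rewrite /extend; case: pselect => // qq0; case: q0K; rewrite -qq0. Qed.

Lemma root_q0 : exists2 x : C, x ^+ 3 = q0.1 ^+ 3 * sheared q0 &
  poly_approx K0 (extend x (fun q => q.1 * v q.1)).
Proof.
pose f (q : C2 R) : C := q.1 * v q.1.
pose P : {poly {poly C}} :=
  'X ^+ 3 * (((3 * t) *: 1 : C)%:P%:P * ('X : {poly C})%:P + 'X ^+ 3).
have PE q : eval2 P q = q.1 ^+ 3 * sheared q.
  rewrite /P !exprS expr0 !mulr1 !(eval2M, eval2D) eval2C eval2X eval2Y.
  by rewrite -scalerAl mul1r /sheared; ring.
have f3 q : K q -> f q ^+ 3 = eval2 P q.
  by move=> Kq; rewrite PE shearedE // exprMn.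
have fA : poly_approx K f.
  apply: poly_approx_cuberoot => [|q /hK[hz _]]; last first.
    by have := sector_zv t32 t0 e1_gt0 e1_le v_near hz.
  apply: (poly_approx_eq (f := eval2 P)) => [q Kq|]; first by rewrite f3.
  apply: (poly_approx_eq (f := fun q => q.1 ^+ 3 * sheared q)) => [q _|]; first by rewrite PE.
  apply: (@poly_approx_sub K0) => [q|]; first by left.
  by apply: poly_approxM approx_sheared; exact: poly_approxX approx_fst.
have [x x3 hx] := hull_cuberoot hull fA f3; exists x; first by rewrite x3 PE.
split.
  have [[M hM] _] := fA; exists (`|M| + nrm x) => q [Kq|->].
    rewrite extend_K //; apply: le_trans (hM _ Kq) _.
    by have := ler_norm M; have := normr_ge0 x; lra.
  by rewrite extend_q0 lerDr.
move=> e /hx[p h1 h2]; exists p => q [Kq|->]; last by rewrite extend_q0.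
by rewrite extend_K //; exact: h1.
Qed.

(** Over the origin the test functions with factor [z^2] vanish at [q0] whatever [q0.2] is, so [W]
    itself is tested. The value of [phi] at [q0] is 0 because its cube [z^3 W] is. *)
Lemma hull_graph_origin : q0.1 = 0 -> q0.2 = 0.
Proof.
move=> a0; have [x x3 hphi] := root_q0; set phi := extend _ _ in hphi.
have x0 : x = 0.
  by move: x3; rewrite a0 expr0n mul0r => /eqP; rewrite expf_eq0 => /eqP.
have ht := t_ge t32 t0; have T2 : 0 < t + 2 by lra.
pose l : R := (2 * (t + 2))^-1.
have l0 : 0 < l by rewrite invr_gt0 mulr_gt0.
have lE : l * (t + 2) = 1 / 2 by rewrite /l; field; rewrite gt_eqF.
suff : sheared q0 = 0.
  by move=> E; apply: scale3t_inj; rewrite scaler0 -E /sheared a0 expr0n addr0.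
have B0 : 0 <= 2 * (t + 2) ^+ 5 / l by rewrite divr_ge0 ?mulr_ge0 ?exprn_ge0 // ltW.
apply: (hull_peak hull (h := fun q => l *: phi q) B0).
- move=> n; apply: poly_approxM; first exact: approx_sheared.
  apply: poly_approxX; apply: poly_approxB; first exact: poly_approx_cst.
  exact: poly_approxZ.
- by rewrite /phi extend_q0 x0 scaler0.
move=> q Kq; have [hz _] := hK Kq; have z1 : nrm q.1 <= 1 := le_trans hz delta1.
have vz := v_norm hz; have hs := sector_zv t32 t0 e1_gt0 e1_le v_near hz.
rewrite /phi extend_K // shearedE //.
set n := nrm (q.1 * v q.1).
have n0 : 0 <= n by exact: normr_ge0.
have v1 : nrm (v q.1) <= t + 2.
  by apply: le_trans vz _; rewrite ler_piMr // ltW.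
have n1 : n <= t + 2.
  rewrite /n RcnormM -[leRHS]mul1r; exact: ler_pM.
have ln : l * n <= 1 / 2 by rewrite -lE ler_pM2l.
have ln0 : 0 <= l * n by rewrite mulr_ge0 // ltW.
(* In the sector [Re phi >= |phi| / 2], so the linear term gains [l n]; as [l n <= 1/2], the
   quadratic term loses at most half of it. *)
exists (l * n / 2); split; first by apply/andP; split; lra.
  rewrite RcnormX.
  have -> : 2 * (t + 2) ^+ 5 / l * (l * n / 2) = (t + 2) ^+ 5 * n.
    by field; rewrite gt_eqF.
  rewrite /n RcnormM -exprM; set m := nrm (v q.1) in vz v1 *.
  have m0 : 0 <= m by exact: normr_ge0.
  have -> : m ^+ (3 * 2) = m ^+ 4 * m * m by rewrite -!exprSr.
  have -> : (t + 2) ^+ 5 * (nrm q.1 * m) = (t + 2) ^+ 4 * ((t + 2) * nrm q.1) * m.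
    by rewrite exprSr; ring.
  rewrite ler_wpM2r //; apply: ler_pM => //; first exact: exprn_ge0.
  by rewrite ler_pXn2r // nnegrE // ltW.
rewrite norm_1B_scale -/n; have := sector_norm hs; rewrite -/n => hn.
have h1 : l * n <= l * (2 * Re (q.1 * v q.1)) by rewrite ler_pM2l.
have h2 : l * n * (l * n) <= 1 / 2 * (l * n) by rewrite ler_wpM2r.
have -> : l ^+ 2 * n ^+ 2 = l * n * (l * n) by ring.
lra.
Qed.

Lemma hull_graph_off_origin : q0.1 <> 0 -> q0.2 = p_t t q0.1 + F q0.1.
Proof.
move=> a0; have [x x3 hphi] := root_q0; set phi := extend _ _ in hphi.
set a := q0.1 in a0 x3; have an0 : a != 0 by apply/eqP.
pose zeta := extend (x / a) (fun q => v q.1).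
have zphi q : K0 q -> phi q = q.1 * zeta q.
  move=> [Kq|->]; first by rewrite /phi /zeta !extend_K.
  by rewrite /phi /zeta !extend_q0 -/a mulrCA divff // mulr1.
have zeta3 q : K0 q -> zeta q ^+ 3 = sheared q.
  move=> [Kq|->]; first by rewrite /zeta extend_K // shearedE.
  rewrite /zeta extend_q0 expr_div_n x3 mulrAC divff ?mul1r //.
  by rewrite expf_neq0.
have zA := approx_fst.
(* Only [phi = z zeta] and [W = zeta^3] are at hand. The factor [z^2] makes the exponents 0, 1 and 2
   available as [z^2], [z phi] and [phi^2], and multiplication by [W] raises the exponent by 3. *)
have zzA n : poly_approx K0 (fun q => q.1 ^+ 2 * zeta q ^+ n).
  suff : [/\ poly_approx K0 (fun q => q.1 ^+ 2 * zeta q ^+ n),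
      poly_approx K0 (fun q => q.1 ^+ 2 * zeta q ^+ n.+1) &
      poly_approx K0 (fun q => q.1 ^+ 2 * zeta q ^+ n.+2)] by case.
  elim: n => [|n [h0 h1 h2]]; split=> //.
  - apply: (poly_approx_eq (f := fun q => q.1 ^+ 2)) => [q _|]; first by rewrite mulr1.
    exact: poly_approxX.
  - apply: (poly_approx_eq (f := fun q => q.1 * phi q)) => [q /zphi->|]; first by ring.
    exact: poly_approxM.
  - apply: (poly_approx_eq (f := fun q => phi q ^+ 2)) => [q /zphi->|]; first by ring.
    exact: poly_approxX.
  apply: (poly_approx_eq (f := fun q => sheared q * (q.1 ^+ 2 * zeta q ^+ n))) => [q /zeta3<-|].
    by rewrite !exprS; ring.
  by apply: poly_approxM => //; exact: approx_sheared.
have ht := t_ge t32 t0; have T1 : 0 < t + 1 by lra.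
pose l : R := (8 * (t + 1) ^+ 2)^-1.
have l0 : 0 < l by rewrite invr_gt0 mulr_gt0 // exprn_gt0.
have lE : l * (t + 1) ^+ 2 = 1 / 8 by rewrite /l; field; rewrite gt_eqF.
pose al := v a.
pose L : C := l *: 1.
have lM (y : C) : l *: y = L * y by rewrite -scalerAl mul1r.
(* Removing [z - a] from [v(z) - v(a)] leaves approximately [t] times the conjugate of [z - a], so
   that the product with [z - a] has positive real part. *)
pose h q := l *: ((q.1 - a) * (zeta q - al - (q.1 - a))).
(* Each factor [1 - h] has degree one in [zeta], so the induction on [m] needs all exponents [n] at
   once. *)
have hA m n : poly_approx K0 (fun q => q.1 ^+ 2 * zeta q ^+ n * (1 - h q) ^+ m).
  elim: m n => [|m IH] n.
    by apply: (poly_approx_eq _ (zzA n)) => q _; rewrite expr0 mulr1.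
  apply: (poly_approx_eq (f := fun q =>
    (1 + l *: ((q.1 - a) * (al + (q.1 - a)))) * (q.1 ^+ 2 * zeta q ^+ n * (1 - h q) ^+ m)
    - l *: (q.1 - a) * (q.1 ^+ 2 * zeta q ^+ n.+1 * (1 - h q) ^+ m))) => [q _|].
    have E : 1 - h q = 1 + l *: ((q.1 - a) * (al + (q.1 - a))) - l *: (q.1 - a) * zeta q.
      by rewrite /h !lM; ring.
    set Z := zeta q in E *; set H := 1 - h q in E *.
    by rewrite (exprS H) (exprS Z); move: (H ^+ m) => Hm; rewrite E !lM; ring.
  have zaA : poly_approx K0 (fun q => q.1 - a).
    by apply: poly_approxB => //; exact: poly_approx_cst.
  apply: poly_approxB; apply: poly_approxM => //; last exact: poly_approxZ.
  apply: poly_approxD; first exact: poly_approx_cst.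
  apply: poly_approxZ; apply: poly_approxM => //.
  by apply: poly_approxD => //; exact: poly_approx_cst.
have B0 : 0 <= 2 * (t + 2) ^+ 2 / l by rewrite divr_ge0 ?mulr_ge0 ?exprn_ge0 ?(ltW l0) //; lra.
have : q0.1 ^+ 2 * (zeta q0 - al) = 0.
  apply: (hull_peak hull (g := fun q => q.1 ^+ 2 * (zeta q - al)) (h := h) B0).
  - move=> n; apply: (poly_approx_eq (f := fun q =>
      q.1 ^+ 2 * zeta q ^+ 1 * (1 - h q) ^+ n - al * (q.1 ^+ 2 * zeta q ^+ 0 * (1 - h q) ^+ n)))
      => [q _|]; first by rewrite expr0 expr1; ring.
    by apply: poly_approxB => //; apply: poly_approxM => //; exact: poly_approx_cst.
  - by rewrite /h subrr mul0r scaler0.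
  move=> q Kq; have [hz _] := hK Kq; have z1 : nrm q.1 <= 1 := le_trans hz delta1.
  have a1 : nrm a <= 1 := le_trans hq0 delta1.
  have := v_lip t32 t0 e1_gt0 e1_le F_lip v3 v_near hz hq0.
  rewrite /h /zeta extend_K // -/a -/al; set E := v q.1 - al - _ => hE.
  set w := q.1 - a in hE *; pose d := nrm w; rewrite -/d in hE.
  have d0 : 0 <= d by exact: normr_ge0.
  have d2 : d <= 2 by have := ler_normB q.1 a; rewrite -/w -/d; lra.
  have wE : v q.1 - al = E + w + t *: (conjc w : C).
    by rewrite /E plane_mapB -/w /plane_map; ring.
  have hd : l * d ^+ 2 <= 1 / 2.
    have : d ^+ 2 <= 2 ^+ 2 by rewrite ler_pXn2r // nnegrE.
    have : l * 1 <= l * (t + 1) ^+ 2 by rewrite ler_pM2l // exprn_ege1 //; lra.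
    move=> h1 h2; have := ler_wpM2l (ltW l0) h2; lra.
  have hd0 : 0 <= l * d ^+ 2 by rewrite mulr_ge0 ?exprn_ge0 // ltW.
  (* The linear term gains [l d^2]; since [l (t + 1)^2 = 1/8] and [d <= 2], the quadratic term is at
     most [l d^2 / 2]. *)
  exists (l * d ^+ 2 / 2); split; first by apply/andP; split; lra.
    have -> : 2 * (t + 2) ^+ 2 / l * (l * d ^+ 2 / 2) = (1 * ((t + 2) * d)) ^+ 2.
      by field; rewrite gt_eqF.
    rewrite ler_pXn2r ?nnegrE ?mulr_ge0 //; last by lra.
    rewrite RcnormM; apply: ler_pM => //; first by rewrite RcnormX exprn_ile1.
    rewrite wE; apply: le_trans (ler_normD _ _) _.
    apply: le_trans (lerD (ler_normD _ _) (lexx _)) _.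
    by rewrite normrZ RcnormJ (gtr0_norm t0) -/d; lra.
  have -> : v q.1 - al - w = E + t *: (conjc w : C) by rewrite wE; ring.
  rewrite norm_1B_scale.
  have h1 : d ^+ 2 / 2 <= Re (w * (E + t *: (conjc w : C))).
    have -> : Re (w * (E + t *: (conjc w : C))) = Re (w * E) + t * d ^+ 2.
      by rewrite /d Rcnorm_sqr !ReImE; ring.
    have := Re_le_norm (w * E); rewrite RcnormM -/d ler_norml => /andP[h1 _].
    have : d * nrm E <= d * (d / 2) by rewrite ler_wpM2l.
    have : 1 * d ^+ 2 <= t * d ^+ 2 by rewrite ler_wpM2r ?exprn_ge0 //; lra.
    lra.
  have h2 : nrm (w * (E + t *: (conjc w : C))) ^+ 2 <= (t + 1) ^+ 2 * d ^+ 2 * d ^+ 2.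
    have -> : (t + 1) ^+ 2 * d ^+ 2 * d ^+ 2 = (d * ((t + 1) * d)) ^+ 2 by ring.
    rewrite ler_pXn2r ?nnegrE ?mulr_ge0 ?(ltW T1) // RcnormM ler_wpM2l //.
    apply: le_trans (ler_normD _ _) _.
    by rewrite normrZ RcnormJ (gtr0_norm t0) -/d; lra.
  have h3 := ler_wpM2l (ltW l0) h1.
  have h4 := ler_wpM2l (exprn_ge0 2 (ltW l0)) h2.
  have h5 : l ^+ 2 * ((t + 1) ^+ 2 * d ^+ 2 * d ^+ 2) =
    (l * (t + 1) ^+ 2) * (l * d ^+ 2) * d ^+ 2 by ring.
  have h6 : (l * d ^+ 2) * d ^+ 2 <= (l * d ^+ 2) * 4.
    rewrite ler_wpM2l // (_ : 4 = 2 ^+ 2 :> R); last by ring.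
    by rewrite ler_pXn2r // nnegrE.
  move: h4; rewrite h5 lE; lra.
rewrite -/a => /eqP; rewrite mulf_eq0 expf_eq0 (negPf an0) /= subr_eq0 => /eqP zal.
apply: scale3t_inj; have := zeta3 q0 (or_intror erefl).
by rewrite zal /al sheared_v // /sheared -/a => /addIr.
Qed.

End GraphHull.

Lemma hull_graph (R : realType) (t e1 delta : R) (F : Rcomplex R -> Rcomplex R)
    (K : set (C2 R)) (q0 : C2 R) :
  3 / 2 <= t ^+ 2 -> 0 < t -> 0 < e1 -> 250 * (1 + t) ^+ 2 * e1 <= 1 ->
  delta <= 1 -> F 0 = 0 ->
  (forall (rho : R) (z a : Rcomplex R), rho <= delta -> `|z| <= rho ->
    `|a| <= rho -> 3 * t * `|F z - F a| <= e1 ^+ 3 * rho ^+ 2 * `|z - a|) ->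
  (forall q, K q -> `|q.1| <= delta /\ q.2 = p_t t q.1 + F q.1) ->
  (forall (p : {poly {poly Rcomplex R}}) (M : R),
    (forall q, K q -> `|eval2 p q| <= M) -> `|eval2 p q0| <= M) ->
  `|q0.1| <= delta -> q0.2 = p_t t q0.1 + F q0.1.
Proof.
move=> t32 t0 e0 e1l d1 F0 F_lip hK hull hq0.
have [/hK[]//|q0K] := pselect (K q0).
have [v hv] := plane_root t0 e0 F0 F_lip.
have v3 z hz := (hv z hz).1; have vn z hz := (hv z hz).2.
have [a0|/eqP a0] := eqVneq q0.1 0; last first.
  exact: (hull_graph_off_origin t32 t0 e0 e1l d1 F_lip v3 vn hull hK hq0 q0K a0).
rewrite (hull_graph_origin t32 t0 e0 e1l d1 v3 vn hull hK hq0 q0K a0) a0 F0 /p_t.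
by rewrite conjc0 !expr0n /= !mul0r !scaler0 !addr0.
Qed.

(** * Functions of class C^k *)

Section ClassC.
Variable R : realType.

Lemma class_CS (V W : normedModType R) n (U : set V) (f : V -> W) :
  class_C n.+1 U f -> class_C n U f.
Proof.
elim: n f => [|n IH] f /= [df Df].
  by move=> x Ux; apply: differentiable_continuous; exact: df.
by split=> // v; apply: IH; exact: Df.
Qed.

Lemma class_C_le (V W : normedModType R) m n (U : set V) (f : V -> W) :
  (m <= n)%N -> class_C n U f -> class_C m U f.
Proof.
move=> /subnK <-; elim: (n - m)%N => [//|d IH] h.
by apply: IH; exact: class_CS.
Qed.

Lemma near_eq_differentiable (V W : normedModType R) (f g : V -> W) (x : V) :
  (\near x, f x = g x) -> differentiable f x -> differentiable g x.
Proof.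
move=> fg /diff_locallyP[cd /eqaddoP fo].
have go : g \o shift x = cst (g x) + 'd f x +o_ 0 id.
  apply/eqaddoP => e e0; have := fo e e0; rewrite -(nbhs_singleton fg).
  move: fg; rewrite (near_shift 0) subr0 => fg0.
  by apply: filter_app; apply: filterS fg0 => y /= E;
     rewrite -[X in _ -> `|X| <= _]/(g (y + x) - _) -E.
by apply/diff_locallyP; rewrite (diff_unique cd go).
Unshelve. all: by end_near. Qed.

(** Rules for derivatives hold only on [U], whereas [class_C] iterates on derivative functions
    defined everywhere; openness of [U] makes equality on [U] sufficient. *)
Lemma class_C_eq (V W : normedModType R) n (U : set V) (f g : V -> W) :
  open U -> (forall x, U x -> f x = g x) -> class_C n U f -> class_C n U g.
Proof.
move=> oU; elim: n f g => [|n IH] f g fg /=.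
  move=> cf x Ux; have cfx : f @ x --> f x := cf _ Ux.
  suff : g @ x --> g x by []; rewrite -(fg _ Ux).
  apply: cvg_trans cfx; apply: near_eq_cvg.
  by near=> y; apply: fg; near: y; exact: open_nbhs_nbhs.
have nfg x : U x -> \near x, f x = g x.
  by move=> Ux; near=> y; apply: fg; near: y; exact: open_nbhs_nbhs.
move=> [df Df]; split=> [x Ux|v].
  by apply: near_eq_differentiable (df _ Ux); exact: nfg.
by apply: IH (Df v) => x Ux; apply: near_eq_derive; exact: nfg.
Unshelve. all: by end_near. Qed.

Lemma class_C_comp_linear (V W W' : normedModType R) n (U : set V) (f : V -> W)
    (L : {linear W -> W'}) : open U -> continuous L -> class_C n U f ->
  class_C n U (L \o f).
Proof.
move=> oU cL; elim: n f => [|n IH] f /=.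
  by move=> cf x Ux; apply: continuous_comp; [exact: cf|exact: cL].
move=> [df Df]; split=> [x Ux|v].
  by apply: differentiable_comp; [exact: df|exact: linear_differentiable].
apply: (class_C_eq (f := L \o 'D_v f)) => // [x Ux|]; last exact: IH.
have dL : differentiable L (f x) by exact: linear_differentiable.
have dLf : differentiable (L \o f) x by apply: differentiable_comp => //; exact: df.
by rewrite (deriveE _ dLf) (diff_comp (df _ Ux) dL) (diff_lin _ cL) /= (deriveE _ (df _ Ux)).
Qed.

Lemma derive_comp_affine (V V' W : normedModType R) (f : V -> W) (i : V' -> V) x v w :
  (forall h : R, i (h *: v + x) = h *: w + i x) -> 'D_v (f \o i) x = 'D_w f (i x).
Proof. by move=> hi; rewrite /derive; under eq_fun do rewrite /= hi. Qed.

Lemma class_C_precomp_linear (V V' W : normedModType R) n (U : set V) (f : V -> W)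
    (i : {linear V' -> V}) : continuous i -> class_C n U f ->
  class_C n (i @^-1` U) (f \o i).
Proof.
move=> ci; elim: n f => [|n IH] f /=.
  by move=> cf x Ux; apply: continuous_comp; [exact: ci|exact: cf].
move=> [df Df]; split=> [x Ux|v].
  by apply: differentiable_comp; [exact: linear_differentiable|exact: df].
rewrite (_ : 'D_v (f \o i) = 'D_(i v) f \o i); first exact: IH.
by apply/funext => x; apply: derive_comp_affine => h; rewrite linearP.
Qed.

Lemma class_C_cst (V W : normedModType R) n (U : set V) (c : W) :
  class_C n U (fun=> c : W).
Proof.
elim: n c => [|n IH] c /=; first by move=> x _; exact: cst_continuous.
split=> [x _|v]; first exact: differentiable_cst.
rewrite (_ : 'D_v _ = fun=> 0); first exact: IH.
by apply/funext => x; exact: derive_cst.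
Qed.

Lemma class_CD (V W : normedModType R) n (U : set V) (f g : V -> W) : open U ->
  class_C n U f -> class_C n U g -> class_C n U (fun x => f x + g x).
Proof.
move=> oU; elim: n f g => [|n IH] f g /=.
  by move=> cf cg x Ux; apply: continuousD; [exact: cf|exact: cg].
move=> [df Df] [dg Dg]; split=> [x Ux|v].
  by apply: differentiableD; [exact: df|exact: dg].
apply: (class_C_eq (f := fun x => 'D_v f x + 'D_v g x)) => // [x Ux|]; last exact: IH.
by rewrite (deriveD (f := f) (g := g)) //; apply: diff_derivable; [exact: df|exact: dg].
Qed.

Lemma class_CM (V : normedModType R) n (U : set V) (f g : V -> R) : open U ->
  class_C n U f -> class_C n U g -> class_C n U (fun x => f x * g x).
Proof.
move=> oU; elim: n f g => [|n IH] f g cf cg.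
  by move=> x Ux; apply: (@continuousM R V f g); [exact: cf|exact: cg].
have cf' := class_CS cf; have cg' := class_CS cg.
move: cf cg => [df Df] [dg Dg]; split=> [x Ux|v].
  by apply: differentiableM; [exact: df|exact: dg].
apply: (class_C_eq (f := fun x => f x * 'D_v g x + 'D_v f x * g x)) => // [x Ux|].
  rewrite (deriveM (f := f) (g := g)); [|apply: diff_derivable; exact: df|apply: diff_derivable; exact: dg].
  have -> : g x *: 'D_v f x = 'D_v f x * g x by exact: mulrC.
  by [].
by apply: class_CD => //; apply: IH => //; first [exact: Df|exact: Dg].
Qed.


Lemma class_CB (V : normedModType R) n (U : set V) (f g : V -> R) : open U ->
  class_C n U f -> class_C n U g -> class_C n U (fun x => f x - g x).
Proof.
move=> oU cf cg; rewrite (_ : (fun x => _) = fun x => f x + (-1) * g x).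
  by apply: class_CD => //; apply: class_CM => //; exact: class_C_cst.
by apply/funext => x; rewrite mulN1r.
Qed.

End ClassC.

(** * Mean value estimates along lines *)

Section LineDerivatives.
Variable R : realType.

Lemma is_derive_line (V : normedModType R) (f : V -> R) (x v : V) (s : R) :
  derivable f (x + s *: v) v ->
  is_derive s 1 (fun a : R => f (x + a *: v)) ('D_v f (x + s *: v)).
Proof.
move=> dv; have E h : f (x + (h *: (1 : R) + s) *: v) = f (h *: v + (x + s *: v)).
  by rewrite (_ : h *: (1 : R) = h); [rewrite scalerDl addrCA|exact: mulr1].
have EE : (fun h : R => h^-1 *: (((fun a : R => f (x + a *: v)) \o shift s) (h *: (1 : R))
      - f (x + s *: v))) =
    (fun h : R => h^-1 *: ((f \o shift (x + s *: v)) (h *: v) - f (x + s *: v))).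
  by apply/funext => h; congr (_ *: (_ - _)); exact: E.
split; first exact: (eq_ind_r (fun F => cvg (F @ 0^')) dv EE).
exact: (eq_ind_r (fun F => lim (F @ 0^') = 'D_v f (x + s *: v)) erefl EE).
Qed.

Lemma mvt (f df : R -> R) (a b : R) : a < b ->
  (forall s, a <= s <= b -> is_derive s 1 f (df s)) ->
  exists2 c, a <= c <= b & f b - f a = df c * (b - a).
Proof.
move=> ab H.
have H1 x : x \in `]a, b[%R -> is_derive x 1 f (df x).
  by rewrite in_itv /= => /andP[h1 h2]; apply: H; rewrite !ltW.
have H2 : {within `[a, b], continuous f}.
  apply: continuous_in_subspaceT => x; rewrite inE /= in_itv /= => xab.
  by apply: differentiable_continuous; apply/derivable1_diffP; have [] := H _ xab.
have [c cab E] := MVT ab H1 H2.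
by exists c => //; move: cab; rewrite in_itv /= => /andP[? ?]; rewrite !ltW.
Qed.

Lemma mvt_small (f df : R -> R) (a b m : R) : a < b ->
  (forall s, a <= s <= b -> is_derive s 1 f (df s)) ->
  `|f a| <= m -> `|f b| <= m ->
  exists2 c, a <= c <= b & `|df c| * (b - a) <= 2 * m.
Proof.
move=> ab H ha hb; have [c cab E] := mvt ab H; exists c => //.
have ba : 0 < b - a by rewrite subr_gt0.
rewrite -[X in _ * X](gtr0_norm ba) -normrM -E.
by apply: le_trans (ler_normB _ _) _; lra.
Qed.

Section Interpolation.
Variables (f0 f1 f2 f3 : R -> R) (rho eta : R).
Hypothesis rho0 : 0 < rho.
Hypothesis d0 : forall s, 0 <= s <= rho -> is_derive s 1 f0 (f1 s).
Hypothesis d1 : forall s, 0 <= s <= rho -> is_derive s 1 f1 (f2 s).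
Hypothesis d2 : forall s, 0 <= s <= rho -> is_derive s 1 f2 (f3 s).
Hypothesis f0_small : forall s, 0 <= s <= rho -> `|f0 s| <= eta * rho ^+ 3.

(** The interval is cut into sevenths. A small value of [f1] is found in one seventh; two such
    sevenths separated by a third give a small value of [f2]; two such triples separated by one more
    seventh (3 + 1 + 3 = 7) give one of [f3]. Each stage costs 14 = 2 * 7. *)
Lemma mvt_gap (f df : R -> R) (a b m : R) :
  (forall s, 0 <= s <= rho -> is_derive s 1 f (df s)) ->
  0 <= a -> b <= rho -> rho / 7 <= b - a -> `|f a| <= m * rho -> `|f b| <= m * rho ->
  exists2 c, a <= c <= b & `|df c| <= 14 * m.
Proof.
move=> H a0 br gap ha hb; have r0 := rho0; have ab : a < b by lra.
have Hab s : a <= s <= b -> is_derive s 1 f (df s).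
  by move=> /andP[h1 h2]; apply: H; apply/andP; split; lra.
have [c cab hc] := mvt_small ab Hab ha hb.
exists c => //; rewrite -(ler_pM2r rho0).
have : `|df c| * (rho / 7) <= `|df c| * (b - a) by exact: ler_wpM2l.
lra.
Qed.

Lemma f1_small_point (a : R) : 0 <= a -> a + rho / 7 <= rho ->
  exists2 c, a <= c <= a + rho / 7 & `|f1 c| <= 14 * eta * rho ^+ 2.
Proof.
move=> a0 ar; have r0 := rho0; rewrite -mulrA.
apply: (mvt_gap d0) => //; first by lra.
  by rewrite -mulrA -exprSr; apply: f0_small; apply/andP; split; lra.
by rewrite -mulrA -exprSr; apply: f0_small; apply/andP; split; lra.
Qed.

Lemma f2_small_point (a : R) : 0 <= a -> a + 3 / 7 * rho <= rho ->
  exists2 c, a <= c <= a + 3 / 7 * rho & `|f2 c| <= 14 * 14 * eta * rho.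
Proof.
move=> a0 ar; have r0 := rho0.
have [|c c1 hc] := f1_small_point a0; first by lra.
have [||d dd hd] := @f1_small_point (a + 2 / 7 * rho); [by lra|by lra|].
move: c1 dd => /andP[? ?] /andP[? ?].
have [|||||b /andP[? ?] hb] := mvt_gap (a := c) (b := d) (m := 14 * eta * rho) d1.
- by lra.
- by lra.
- by lra.
- by rewrite -mulrA -expr2.
- by rewrite -mulrA -expr2.
by exists b; [apply/andP; split; lra|lra].
Qed.

Lemma f3_small_point : exists2 c, 0 <= c <= rho & `|f3 c| <= 14 * 14 * 14 * eta.
Proof.
have r0 := rho0; have [||c /andP[? ?] hc] := @f2_small_point 0; [by lra|by lra|].
have [||d /andP[? ?] hd] := @f2_small_point (4 / 7 * rho); [by lra|by lra|].
have [|||||b /andP[? ?] hb] := mvt_gap (a := c) (b := d) (m := 14 * 14 * eta) d2.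
- by lra.
- by lra.
- by lra.
- exact: hc.
- exact: hd.
by exists b; [apply/andP; split; lra|lra].
Qed.

(** Going back down from the bound on [f3]: [f2] and [f1] are each small at some point, hence
    everywhere up to the variation allowed by the next derivative; 210 = 14 + 14 * 14. *)
Lemma f1_bound (B : R) : (forall s, 0 <= s <= rho -> `|f3 s| <= B) ->
  `|f1 0| <= 210 * eta * rho ^+ 2 + B * rho ^+ 2.
Proof.
move=> hB; have r0 := rho0.
have incr (f df : R -> R) (a b m : R) :
    (forall s, 0 <= s <= rho -> is_derive s 1 f (df s)) ->
    (forall s, 0 <= s <= rho -> `|df s| <= m) ->
    0 <= a <= rho -> 0 <= b <= rho -> `|f b| <= `|f a| + m * rho.
  move=> H hm a0 b0.
  have lt x y : 0 <= x <= rho -> 0 <= y <= rho -> x < y -> `|f y - f x| <= m * rho.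
    move=> /andP[x0 xr] /andP[y0 yr] xy.
    have [s /andP[h1 h2]|c /andP[? ?] E] := mvt xy (f := f) (df := df).
      by apply: H; apply/andP; split; lra.
    rewrite E normrM [`|y - x|]gtr0_norm ?subr_gt0 //; apply: ler_pM => //.
    - by rewrite subr_ge0 ltW.
    - by apply: hm; apply/andP; split; lra.
    - by lra.
  have : `|f b - f a| <= m * rho.
    have [ab|ba|->] := ltgtP a b; [exact: lt|by rewrite distrC; exact: lt|].
    rewrite subrr normr0; apply: mulr_ge0; last exact: ltW.
    exact: le_trans (normr_ge0 _) (hm _ b0).
  by have := ler_normD (f b - f a) (f a); rewrite subrK; lra.
have [||c /andP[c0 c1] hc] := @f2_small_point 0; [by lra|by lra|].
have h2 s : 0 <= s <= rho -> `|f2 s| <= (14 * 14 * eta + B) * rho.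
  move=> hs; have := incr _ _ c s B d2 hB; rewrite hs (_ : 0 <= c <= rho).
    by move=> /(_ isT isT); lra.
  by apply/andP; split; lra.
have [||d /andP[dd0 dd1] hd] := @f1_small_point 0; [by lra|by lra|].
have := incr _ _ d 0 _ d1 h2; rewrite lexx (ltW r0) (_ : 0 <= d <= rho).
  by move=> /(_ isT isT); rewrite -mulrA -expr2; lra.
by apply/andP; split; lra.
Qed.

End Interpolation.
End LineDerivatives.

(** * Flatness at a point *)

Section Flatness.
Variable R : realType.
Local Notation C := (Rcomplex R).
Local Notation nrm x := (`|(x : C)|).
Local Notation Re := (@complex.Re R).
Local Notation Im := (@complex.Im R).

Lemma nbhs_closed_ball (V : normedModType R) (x0 : V) (P : set V) : nbhs x0 P ->
  exists2 d : R, 0 < d & forall x, `|x - x0| <= d -> P x.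
Proof.
move=> /nbhs_normP[e /= e0 h]; exists (e / 2); first by lra.
by move=> x hx; apply: h; rewrite /= distrC; lra.
Qed.

Lemma continuous_close (V W : normedModType R) (f : V -> W) (x0 : V) (e : R) :
  {for x0, continuous f} -> 0 < e ->
  exists2 d : R, 0 < d & forall x, `|x - x0| <= d -> `|f x - f x0| <= e.
Proof.
move=> /cvgrPdist_le cf e0; have [d d0 hd] := nbhs_closed_ball (cf e e0).
by exists d => // x /hd; rewrite distrC.
Qed.

Lemma ler_norm_close (a b e B : R) : `|a - b| <= e -> `|b| <= B -> `|a| <= B + e.
Proof. by move=> h1 h2; have := ler_normD (a - b) b; rewrite subrK; lra. Qed.

Lemma derive_flat_constant (h r : R) : 0 <= h * r ->
  210 * (8 * h) * r + (14 * 14 * 14 * h + h + h) * r <= 20 * 20 * 20 * h * r.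
Proof. by move=> hr; lra. Qed.

(** Flatness of [f] forces the third derivative to be small at a point near [x0], hence at [x0] and
    around it by continuity. Then [f1_bound] turns this and the flatness into a bound for the first
    derivative. *)
Lemma derive_flat (V : normedModType R) (U : set V) (f : V -> R) (x0 v : V) :
  open U -> U x0 -> `|v| = 1 -> class_C 3 U f ->
  (forall e : R, 0 < e -> exists2 d : R, 0 < d & forall x, `|x - x0| <= d ->
    `|f x| <= e * `|x - x0| ^+ 3) ->
  forall e : R, 0 < e -> exists2 d : R, 0 < d & forall (rho : R) x, 0 < rho <= d ->
    `|x - x0| <= rho -> `|'D_v f x| <= e * rho ^+ 2.
Proof.
move=> oU U0 v1 [df /(_ v)[d1f /(_ v)[d2f /(_ v) cf]]] flat e e0.
pose h := e / (20 * 20 * 20); have h0 : 0 < h by rewrite /h; lra.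
have [da da0 hda] := flat h h0.
have [db db0 hdb] := continuous_close (cf _ U0) h0.
have [dc dc0 hdc] := nbhs_closed_ball (open_nbhs_nbhs (conj oU U0)).
pose d := Num.min da (Num.min db dc) / 2.
have d0 : 0 < d by rewrite divr_gt0 // !lt_min da0 db0 dc0.
have dE : 2 * d = Num.min da (Num.min db dc) by rewrite /d mulrC divfK // pnatr_eq0.
have d2 x : `|x - x0| <= 2 * d ->
    [/\ `|x - x0| <= da, `|x - x0| <= db & `|x - x0| <= dc].
  by rewrite dE !le_min => /and3P[].
have line x (rho : R) s : `|x - x0| <= rho -> 0 <= s <= rho -> rho <= d ->
    `|x + s *: v - x0| <= 2 * rho.
  move=> hx /andP[s0 sr] _; rewrite addrAC.
  apply: le_trans (ler_normD _ _) _; rewrite normrZ v1 mulr1 ger0_norm //; lra.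
have dline (g : V -> R) x (rho : R) s : (forall y, U y -> differentiable g y) ->
    `|x - x0| <= rho -> 0 <= s <= rho -> rho <= d ->
    is_derive s 1 (fun a : R => g (x + a *: v)) ('D_v g (x + s *: v)).
  move=> dg hx hs rd; apply: is_derive_line; apply: diff_derivable; apply: dg; apply: hdc.
  by have [] := d2 (x + s *: v); first by (have := line _ _ _ hx hs rd; lra).
have D3 : `|'D_v ('D_v ('D_v f)) x0| <= 14 * 14 * 14 * h + h.
  have x00 : `|x0 - x0| <= d by rewrite subrr normr0 ltW.
  have small s : 0 <= s <= d -> `|f (x0 + s *: v)| <= h * d ^+ 3.
    move=> hs; have [|ha _ _] := d2 (x0 + s *: v); first exact: line x00 hs (lexx _).
    apply: le_trans (hda _ ha) _; apply: ler_wpM2l; first exact: ltW.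
    rewrite addrAC subrr add0r normrZ v1 mulr1.
    by move: hs => /andP[s0 sd]; rewrite ger0_norm // ler_pXn2r // nnegrE // ltW.
  have [c hc h3] := f3_small_point d0
    (fun s hs => dline f x0 d s df x00 hs (lexx _))
    (fun s hs => dline _ x0 d s d1f x00 hs (lexx _))
    (fun s hs => dline _ x0 d s d2f x00 hs (lexx _)) small.
  have [|_ hb _] := d2 (x0 + c *: v); first exact: line x00 hc (lexx _).
  by have := hdb _ hb; rewrite distrC => h4; exact: ler_norm_close h4 h3.
exists d => // rho x /andP[r0 rd] hx.
(* The segment of length [rho] from [x] stays within [2 rho] of [x0]; hence 8 = 2^3. *)
have small s : 0 <= s <= rho -> `|f (x + s *: v)| <= (8 * h) * rho ^+ 3.
  move=> hs; have hl := line _ _ _ hx hs rd.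
  have [|ha _ _] := d2 (x + s *: v); first by lra.
  apply: le_trans (hda _ ha) _.
  have -> : 8 * h * rho ^+ 3 = h * (2 * rho) ^+ 3 by ring.
  apply: ler_wpM2l; first exact: ltW.
  by rewrite ler_pXn2r // nnegrE // mulr_ge0 // ltW.
have B s : 0 <= s <= rho -> `|'D_v ('D_v ('D_v f)) (x + s *: v)| <= 14 * 14 * 14 * h + h + h.
  move=> hs; have hl := line _ _ _ hx hs rd.
  have [|_ hb _] := d2 (x + s *: v); first by lra.
  exact: ler_norm_close (hdb _ hb) D3.
have := f1_bound r0
    (fun s hs => dline f x rho s df hx hs rd)
    (fun s hs => dline _ x rho s d1f hx hs rd)
    (fun s hs => dline _ x rho s d2f hx hs rd) small B.
rewrite scale0r addr0 => X; apply: le_trans X _.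
have r2 : 0 <= rho ^+ 2 by rewrite exprn_ge0 // ltW.
have -> : e = 20 * 20 * 20 * h by rewrite /h; field.
by apply: derive_flat_constant; apply: mulr_ge0 r2; exact: ltW.
Qed.

Lemma lipschitz_line (V : normedModType R) (f : V -> R) (x v : V) (s m : R) :
  (forall a : R, `|a| <= `|s| -> derivable f (x + a *: v) v /\
    `|'D_v f (x + a *: v)| <= m) ->
  `|f (x + s *: v) - f x| <= m * `|s|.
Proof.
move=> H; have D (a : R) : `|a| <= `|s| ->
    is_derive a 1 (fun a : R => f (x + a *: v)) ('D_v f (x + a *: v)).
  by move=> /H[d _]; exact: is_derive_line.
have [s0|s0|->] := ltgtP s 0.
- have [a|c /andP[c0 c1] E] := mvt s0 (f := fun a : R => f (x + a *: v))
    (df := fun a : R => 'D_v f (x + a *: v)).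
    by move=> /andP[h1 h2]; apply: D; rewrite !ler0_norm ?lerN2 // ltW.
  rewrite scale0r addr0 in E.
  rewrite distrC E normrM sub0r normrN ler_wpM2r //; have [] := H c => //.
  by rewrite !ler0_norm ?lerN2 // ltW.
- have [a|c /andP[c0 c1] E] := mvt s0 (f := fun a : R => f (x + a *: v))
    (df := fun a : R => 'D_v f (x + a *: v)).
    by move=> /andP[h1 h2]; apply: D; rewrite !ger0_norm // ltW.
  rewrite scale0r addr0 in E.
  rewrite E normrM subr0 ler_wpM2r //; have [] := H c => //.
  by rewrite !ger0_norm // ltW.
by rewrite scale0r addr0 subrr !normr0 mulr0.
Qed.

Lemma lipschitz_path2 (V : normedModType R) (f : V -> R) (x v w : V) (s s' m : R) :
  (forall a b : R, `|a| <= `|s| -> `|b| <= `|s'| ->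
    [/\ differentiable f (x + a *: v + b *: w),
        `|'D_v f (x + a *: v + b *: w)| <= m &
        `|'D_w f (x + a *: v + b *: w)| <= m]) ->
  `|f (x + s *: v + s' *: w) - f x| <= m * (`|s| + `|s'|).
Proof.
move=> H; have -> : f (x + s *: v + s' *: w) - f x =
    (f (x + s *: v) - f x) + (f (x + s *: v + s' *: w) - f (x + s *: v)) by ring.
apply: le_trans (ler_normD _ _) _; rewrite mulrDr lerD //.
  apply: lipschitz_line => a ha; have [|dfa h1 _] := H a 0 ha.
    by rewrite normr0.
  by rewrite scale0r addr0 in dfa h1; split=> //; exact: diff_derivable.
apply: lipschitz_line => b hb; have [dfa _ h1] := H s b (lexx _) hb.
by split=> //; exact: diff_derivable.
Qed.

Lemma ReIm_decomp (x : C) : x = Re x *: 1 + Im x *: ('i%C : C).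
Proof. by apply: ReIm_inj; rewrite !ReImE /=; ring. Qed.

Lemma norm_ReIm_le (a b : R) (x : C) : `|a| <= `|Re x| -> `|b| <= `|Im x| ->
  nrm (a *: 1 + b *: ('i%C : C)) <= nrm x.
Proof.
move=> ha hb; rewrite -(@ler_pXn2r _ 2) ?nnegrE // !Rcnorm_sqr !ReImE /=.
rewrite !(mulr0, mulr1, addr0, add0r).
by apply: lerD; rewrite -[_ ^+ 2]real_normK ?num_real // -[leRHS]real_normK ?num_real //
  ler_pXn2r // nnegrE.
Qed.

Lemma ReIm_sum_le (x : C) : `|Re x| + `|Im x| <= 2 * nrm x.
Proof. by have := Re_le_norm x; have := Im_le_norm x; lra. Qed.

(** The path runs in the real direction and then in the imaginary one. It may leave the ball of
    radius [rho], but its points are within [|y - x| <= 2 rho] of [x], hence within [3 rho] of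
    [x0]. *)
Lemma lipschitz_C (f : C -> R) (x0 x y : C) (rho m : R) : 0 <= m ->
  (forall z, `|z - x0| <= 3 * rho -> [/\ differentiable f z, `|'D_1 f z| <= m &
    `|'D_('i%C : C) f z| <= m]) ->
  `|x - x0| <= rho -> `|y - x0| <= rho -> `|f y - f x| <= 2 * m * `|y - x|.
Proof.
move=> m0 H hx hy.
have E : y = x + Re (y - x) *: 1 + Im (y - x) *: ('i%C : C).
  by rewrite -addrA -ReIm_decomp addrC subrK.
rewrite {1}E; apply: (@le_trans _ _ (m * (`|Re (y - x)| + `|Im (y - x)|))); last first.
  by have := ler_wpM2l m0 (ReIm_sum_le (y - x)); lra.
apply: lipschitz_path2 => a b ha hb; apply: H.
have := norm_ReIm_le ha hb; have := ler_normD (x - x0) (a *: 1 + b *: ('i%C : C)).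
have := ler_normB (y - x0) (x - x0).
have -> : y - x0 - (x - x0) = y - x by ring.
have -> : x - x0 + (a *: 1 + b *: ('i%C : C)) = x + a *: 1 + b *: ('i%C : C) - x0 by ring.
lra.
Qed.

Lemma lipschitz_C2 (f : C2 R -> R) (q0 q q' : C2 R) (rho m : R) : 0 <= m ->
  (forall z, `|z - q0| <= 3 * rho -> [/\ differentiable f z,
     `|'D_((1 : C), (0 : C)) f z| <= m, `|'D_(('i%C : C), (0 : C)) f z| <= m,
     `|'D_((0 : C), (1 : C)) f z| <= m & `|'D_((0 : C), ('i%C : C)) f z| <= m]) ->
  `|q - q0| <= rho -> `|q' - q0| <= rho ->
  `|f q' - f q| <= 2 * m * (nrm (q'.1 - q.1) + nrm (q'.2 - q.2)).
Proof.
move=> m0 H hq hq'.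
pose p : C2 R := (q'.1, q.2).
have dec1 : p = q + Re (q'.1 - q.1) *: ((1 : C), (0 : C))
    + Im (q'.1 - q.1) *: (('i%C : C), (0 : C)).
  case: q q' hq hq' @p => [z w] [z' w'] _ _ /=; congr (_, _) => /=.
    by rewrite -addrA -ReIm_decomp addrC subrK.
  by rewrite !scaler0 !addr0.
have dec2 : q' = p + Re (q'.2 - q.2) *: ((0 : C), (1 : C))
    + Im (q'.2 - q.2) *: ((0 : C), ('i%C : C)).
  rewrite /p; clear dec1 p; case: q q' hq hq' => [z w] [z' w'] _ _ /=; congr (_, _) => /=.
    by rewrite !scaler0 !addr0.
  by rewrite -addrA -ReIm_decomp addrC subrK.
have nE (x : C2 R) (c : R) : (`|x| <= c) = (nrm x.1 <= c) && (nrm x.2 <= c).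
  by rewrite prod_normE ge_max.
move: (hq) (hq'); rewrite !nE /= => /andP[q1 q2] /andP[q1' q2'].
have r0 : 0 <= rho by exact: le_trans (normr_ge0 _) hq.
have mv (x y x0 : C) a b : nrm (x - x0) <= rho -> nrm (y - x0) <= rho ->
    `|a| <= `|Re (y - x)| -> `|b| <= `|Im (y - x)| ->
    nrm (x + a *: 1 + b *: ('i%C : C) - x0) <= 3 * rho.
  move=> hx hy ha hb.
  have := norm_ReIm_le ha hb; have := ler_normD (x - x0) (a *: 1 + b *: ('i%C : C)).
  have := ler_normB (y - x0) (x - x0).
  have -> : y - x0 - (x - x0) = y - x by ring.
  have -> : x - x0 + (a *: 1 + b *: ('i%C : C)) = x + a *: 1 + b *: ('i%C : C) - x0 by ring.
  lra.
have h1 : `|f p - f q| <= m * (`|Re (q'.1 - q.1)| + `|Im (q'.1 - q.1)|).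
  rewrite {1}dec1; apply: lipschitz_path2 => a b ha hb.
  suff /H[d1 d2 d3 _ _] :
      `|q + a *: ((1 : C), (0 : C)) + b *: (('i%C : C), (0 : C)) - q0| <= 3 * rho.
    by split; [exact: d1|exact: d2|exact: d3].
  rewrite nE /= !scaler0 !addr0 (mv _ q'.1) //=; lra.
have h2 : `|f q' - f p| <= m * (`|Re (q'.2 - q.2)| + `|Im (q'.2 - q.2)|).
  rewrite {1}dec2; apply: lipschitz_path2 => a b ha hb.
  suff /H[d1 _ _ d2 d3] :
      `|p + a *: ((0 : C), (1 : C)) + b *: ((0 : C), ('i%C : C)) - q0| <= 3 * rho.
    by split; [exact: d1|exact: d2|exact: d3].
  rewrite nE /= !scaler0 !addr0 (mv _ q'.2) //= andbT; lra.
have := ler_wpM2l m0 (ReIm_sum_le (q'.1 - q.1)).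
have := ler_wpM2l m0 (ReIm_sum_le (q'.2 - q.2)).
have -> : f q' - f q = (f q' - f p) + (f p - f q) by ring.
by have := ler_normD (f q' - f p) (f p - f q); lra.
Qed.

Lemma class_C1_lipschitz_C (U : set C) (f : C -> R) (x0 : C) (m e : R) :
  open U -> U x0 -> class_C 1 U f -> `|'D_1 f x0| <= m ->
  `|'D_('i%C : C) f x0| <= m -> 0 < e ->
  exists2 d : R, 0 < d & forall x y, `|x - x0| <= d -> `|y - x0| <= d ->
    `|f y - f x| <= 2 * (m + e) * `|y - x|.
Proof.
move=> oU U0 [df cf] m1 m2 e0.
have [da da0 hda] := continuous_close (cf 1 _ U0) e0.
have [db db0 hdb] := continuous_close (cf ('i%C : C) _ U0) e0.
have [dc dc0 hdc] := nbhs_closed_ball (open_nbhs_nbhs (conj oU U0)).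
pose d := Num.min da (Num.min db dc) / 3.
have d0 : 0 < d by rewrite divr_gt0 // !lt_min da0 db0 dc0.
have dE : 3 * d = Num.min da (Num.min db dc) by rewrite /d mulrC divfK // pnatr_eq0.
exists d => // x y; apply: lipschitz_C.
  by have := normr_ge0 ('D_1 f x0); lra.
move=> z; rewrite dE !le_min => /and3P[ha hb hc]; split.
- by apply: df; exact: hdc.
- exact: ler_norm_close (hda _ ha) m1.
- exact: ler_norm_close (hdb _ hb) m2.
Qed.

Lemma four_bound (a b c d : R) : 0 <= a -> 0 <= b -> 0 <= c -> 0 <= d ->
  exists2 m : R, 0 < m & [/\ a + 1 <= m, b + 1 <= m, c + 1 <= m & d + 1 <= m].
Proof. by move=> *; exists (a + b + c + d + 1); [lra|split; lra]. Qed.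

Lemma class_C1_lipschitz_C2 (U : set (C2 R)) (f : C2 R -> R) (q0 : C2 R) :
  open U -> U q0 -> class_C 1 U f ->
  exists2 L : R, 0 < L & exists2 d : R, 0 < d & forall q q',
    `|q - q0| <= d -> `|q' - q0| <= d ->
    `|f q' - f q| <= L * (nrm (q'.1 - q.1) + nrm (q'.2 - q.2)).
Proof.
move=> oU U0 [df cf].
pose D (v : C2 R) := `|'D_v f q0|.
have D0 v : 0 <= D v by exact: normr_ge0.
have [m m0 [m1 m2 m3 m4]] := four_bound (D0 ((1 : C), (0 : C)))
  (D0 (('i%C : C), (0 : C))) (D0 ((0 : C), (1 : C))) (D0 ((0 : C), ('i%C : C))).
have bnd v : exists2 d : R, 0 < d & forall q, `|q - q0| <= d -> `|'D_v f q| <= D v + 1.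
  have [d d0 hd] := continuous_close (cf v _ U0) ltr01; exists d => // q /hd h.
  exact: ler_norm_close h (lexx _).
have [da da0 hda] := bnd ((1 : C), (0 : C)).
have [db db0 hdb] := bnd (('i%C : C), (0 : C)).
have [dc dc0 hdc] := bnd ((0 : C), (1 : C)).
have [dd dd0 hdd] := bnd ((0 : C), ('i%C : C)).
have [de de0 hde] := nbhs_closed_ball (open_nbhs_nbhs (conj oU U0)).
pose d := Num.min da (Num.min db (Num.min dc (Num.min dd de))) / 3.
have d0 : 0 < d by rewrite divr_gt0 // !lt_min da0 db0 dc0 dd0 de0.
have dE : 3 * d = Num.min da (Num.min db (Num.min dc (Num.min dd de))) by rewrite /d mulrC divfK // pnatr_eq0.
exists (2 * m); first by rewrite mulr_gt0.
exists d => // q q'; apply: lipschitz_C2; first exact: ltW.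
move=> z; rewrite dE !le_min => /and5P[/hda ha /hdb hb /hdc hc /hdd hd /hde he].
split; [exact: df|exact: le_trans ha m1|exact: le_trans hb m2|
  exact: le_trans hc m3|exact: le_trans hd m4].
Qed.

Lemma norm_i : nrm ('i%C : C) = 1.
Proof. by rewrite RcnormE /= expr0n expr1n add0r sqrtr1. Qed.

Lemma flat_lipschitz (U : set C) (f : C -> R) (x0 : C) :
  open U -> U x0 -> class_C 3 U f ->
  (forall e : R, 0 < e -> exists2 d : R, 0 < d & forall x, `|x - x0| <= d ->
    `|f x| <= e * `|x - x0| ^+ 3) ->
  forall e : R, 0 < e -> exists2 d : R, 0 < d & forall (rho : R) x y, 0 < rho <= d ->
    `|x - x0| <= rho -> `|y - x0| <= rho -> `|f y - f x| <= e * rho ^+ 2 * `|y - x|.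
Proof.
move=> oU U0 cf flat e e0.
(* 18 = 2 * 3^2: the factor 2 of [lipschitz_C], and the radius [3 rho]. *)
pose h := e / 18; have h0 : 0 < h by rewrite /h; lra.
have [da da0 hda] := derive_flat oU U0 (Rcnorm1 R) cf flat h0.
have [db db0 hdb] := derive_flat oU U0 norm_i cf flat h0.
have [dc dc0 hdc] := nbhs_closed_ball (open_nbhs_nbhs (conj oU U0)).
pose d := Num.min da (Num.min db dc) / 3.
have d0 : 0 < d by rewrite divr_gt0 // !lt_min da0 db0 dc0.
have dE : 3 * d = Num.min da (Num.min db dc) by rewrite /d mulrC divfK // pnatr_eq0.
exists d => // rho x y /andP[r0 rd] hx hy.
have r2 : 0 <= rho ^+ 2 by rewrite exprn_ge0 // ltW.
have -> : e * rho ^+ 2 = 2 * (h * (3 * rho) ^+ 2) by rewrite /h; field.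
have : 3 * rho <= Num.min da (Num.min db dc) by rewrite -dE; lra.
rewrite !le_min => /and3P[ra rb rc].
apply: (lipschitz_C (x0 := x0) (rho := rho)) => //.
  by rewrite mulr_ge0 ?(ltW h0) // exprn_ge0 // mulr_ge0 // ltW.
have r3 : 0 < 3 * rho by rewrite mulr_gt0.
move=> z hz; split.
- by apply: (cf.1); apply: hdc; exact: le_trans hz rc.
- by apply: hda => //; rewrite r3.
- by apply: hdb => //; rewrite r3.
Qed.

End Flatness.

(** * Regularity of the remainder *)

Section Coordinates.
Variable R : realType.
Local Notation C := (Rcomplex R).
Local Notation nrm x := (`|(x : C)|).
Local Notation Re := (@complex.Re R).
Local Notation Im := (@complex.Im R).

Lemma C2_norm_le (q : C2 R) (c : R) : (`|q| <= c) = (nrm q.1 <= c) && (nrm q.2 <= c).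
Proof. by rewrite prod_normE ge_max. Qed.

Lemma linear_continuous_C2 (V : normedModType R) (L : {linear C2 R -> V}) :
  (forall q, `|L q| <= `|q|) -> continuous L.
Proof.
move=> hL q; apply/cvgrPdist_le => e e0; near=> q'.
rewrite -linearB; apply: le_trans (hL _) _.
by near: q'; move: e e0; apply/cvgrPdist_le; exact: cvg_id.
Unshelve. all: by end_near. Qed.

Definition re1 (q : C2 R) : R^o := Re q.1.
Definition im1 (q : C2 R) : R^o := Im q.1.
Definition re2 (q : C2 R) : R^o := Re q.2.
Definition im2 (q : C2 R) : R^o := Im q.2.
Definition horizontal (x : C) : C2 R := (x, 0).

Fact re1_linear : linear re1. Proof. by move=> a x y; rewrite /re1 /= !ReImE. Qed.
Fact im1_linear : linear im1. Proof. by move=> a x y; rewrite /im1 /= !ReImE. Qed.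
Fact re2_linear : linear re2. Proof. by move=> a x y; rewrite /re2 /= !ReImE. Qed.
Fact im2_linear : linear im2. Proof. by move=> a x y; rewrite /im2 /= !ReImE. Qed.
Fact horizontal_linear : linear horizontal.
Proof. by move=> a x y; congr (_, _) => /=; rewrite scaler0 addr0. Qed.

HB.instance Definition _ := GRing.isLinear.Build R (C2 R) R^o *:%R re1 re1_linear.
HB.instance Definition _ := GRing.isLinear.Build R (C2 R) R^o *:%R im1 im1_linear.
HB.instance Definition _ := GRing.isLinear.Build R (C2 R) R^o *:%R re2 re2_linear.
HB.instance Definition _ := GRing.isLinear.Build R (C2 R) R^o *:%R im2 im2_linear.
HB.instance Definition _ := GRing.isLinear.Build R C (C2 R) *:%R horizontal horizontal_linear.

Lemma fst_le (q : C2 R) : nrm q.1 <= `|q|.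
Proof. by have := lexx `|q|; rewrite C2_norm_le => /andP[]. Qed.

Lemma snd_le (q : C2 R) : nrm q.2 <= `|q|.
Proof. by have := lexx `|q|; rewrite C2_norm_le => /andP[]. Qed.

Lemma continuous_re1 : continuous re1.
Proof.
by apply: linear_continuous_C2 => q; exact: le_trans (Re_le_norm _) (fst_le _).
Qed.
Lemma continuous_im1 : continuous im1.
Proof.
by apply: linear_continuous_C2 => q; exact: le_trans (Im_le_norm _) (fst_le _).
Qed.
Lemma continuous_re2 : continuous re2.
Proof.
by apply: linear_continuous_C2 => q; exact: le_trans (Re_le_norm _) (snd_le _).
Qed.
Lemma continuous_im2 : continuous im2.
Proof.
by apply: linear_continuous_C2 => q; exact: le_trans (Im_le_norm _) (snd_le _).
Qed.

Lemma continuous_horizontal : continuous horizontal.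
Proof.
have cont (V W : normedModType R) : continuous (fun x : V => (x, 0 : W)).
  move=> x; apply: (cvg_pair (F := nbhs x) (G := nbhs x) (H := nbhs (0 : W))
    (f := id) (g := cst 0)); [exact: cvg_id|exact: cvg_cst].
exact: cont.
Qed.

(** On a segment of length [s] at [x0] the mean value theorem yields a point where the derivative is
    at most [2 B' s]; continuity at [x0] does the rest. *)
Lemma derive_quadratic0 (V : normedModType R) (U : set V) (f : V -> R) (x0 v : V)
    (B d : R) : open U -> U x0 -> `|v| = 1 -> class_C 1 U f -> 0 < d ->
  (forall x, `|x - x0| <= d -> `|f x| <= B * `|x - x0| ^+ 2) -> 'D_v f x0 = 0.
Proof.
move=> oU U0 v1 [df cf] d0 hB.
have [dc dc0 hdc] := nbhs_closed_ball (open_nbhs_nbhs (conj oU U0)).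
apply/eqP; rewrite -normr_le0; apply/ler_addgt0Pr => e e0; rewrite add0r.
have e2 : 0 < e / 2 by lra.
have [da da0 hda] := continuous_close (cf v _ U0) e2.
pose B' := `|B| + 1; have B0 : 0 < B' by rewrite /B' ltr_wpDl.
pose s := Num.min (Num.min d (Num.min da dc)) (e / (4 * B')).
have s0 : 0 < s by rewrite !lt_min d0 da0 dc0 divr_gt0 // mulr_gt0.
have : s <= s by [].
rewrite {2}/s !le_min => /andP[/andP[sd /andP[sa sc]]].
rewrite ler_pdivlMr ?mulr_gt0 // => se.
have near0 (a : R) : `|x0 + a *: v - x0| = `|a|.
  by rewrite addrAC subrr add0r normrZ v1 mulr1.
have D (a : R) : 0 <= a <= s ->
    is_derive a 1 (fun b : R => f (x0 + b *: v)) ('D_v f (x0 + a *: v)).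
  move=> /andP[a0 as_]; apply: is_derive_line; apply: diff_derivable; apply: df.
  by apply: hdc; rewrite near0 ger0_norm //; exact: le_trans as_ sc.
have hf (a : R) : 0 <= a <= s -> `|f (x0 + a *: v)| <= B' * s ^+ 2.
  move=> /andP[a0 as_]; have := hB (x0 + a *: v); rewrite near0 ger0_norm //.
  move=> /(_ (le_trans as_ sd)) h; apply: le_trans h _.
  apply: le_trans (ler_wpM2r (exprn_ge0 2 a0) (_ : B <= B')) _.
    by rewrite /B'; have := ler_norm B; lra.
  by rewrite ler_wpM2l ?(ltW B0) // ler_pXn2r // nnegrE // ltW.
have s00 : (0 : R) <= 0 <= s by apply/andP; split; [exact: lexx|exact: ltW].
have sss : 0 <= s <= s by apply/andP; split; [exact: ltW|exact: lexx].
have [c cs] := mvt_small s0 D (hf 0 s00) (hf s sss).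
rewrite subr0 => hc; have c1 : `|'D_v f (x0 + c *: v)| <= e / 2.
  rewrite -(ler_pM2r s0); apply: le_trans hc _.
  have -> : 2 * (B' * s ^+ 2) = (s * (4 * B')) / 2 * s by field.
  by apply: ler_wpM2r; [exact: ltW|lra].
have : `|x0 + c *: v - x0| <= da.
  by move: cs => /andP[c0 cs]; rewrite near0 ger0_norm //; exact: le_trans cs sa.
move=> /hda; rewrite distrC => h; have := ler_norm_close h c1; lra.
Qed.

End Coordinates.

(** * The graphing function near the origin *)

Section GraphRegularity.
Variable R : realType.
Local Notation C := (Rcomplex R).
Local Notation nrm x := (`|(x : C)|).
Local Notation Re := (@complex.Re R).
Local Notation Im := (@complex.Im R).
Variables (k : nat) (t r : R) (M : set (C2 R)) (F : C -> C).
Hypothesis hk : (3 <= k)%N.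
Hypothesis t0 : 0 < t.
Hypothesis hM : real_surface k M.
Hypothesis M0 : M 0.
Hypothesis r0 : 0 < r.
Hypothesis hgraph : M `&` eclosed_ball 0 r =
  [set q | eclosed_ball 0 r q /\ q.2 = p_t t q.1 + F q.1].
Hypothesis hF : F =o_ ((0 : C)^') (fun z => `|z| ^+ 3 : R).

Local Notation f z := (p_t t (z : C) + F z).

Lemma p_t0 : p_t t (0 : C) = 0.
Proof. by rewrite /p_t conjc0 !expr0n /= !mul0r !scaler0 !addr0. Qed.

Lemma enorm_le (q : C2 R) : enorm q <= nrm q.1 + nrm q.2.
Proof.
rewrite -(@ler_pXn2r _ 2) ?nnegrE ?sqrtr_ge0 ?addr_ge0 //.
rewrite sqr_sqrtr ?addr_ge0 ?exprn_ge0 //.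
by have := mulr_ge0 (normr_ge0 q.1) (normr_ge0 q.2); rewrite sqrrD; lra.
Qed.

Lemma le_enorm (q : C2 R) : nrm q.1 <= enorm q /\ nrm q.2 <= enorm q.
Proof.
have a0 := exprn_ge0 2 (normr_ge0 q.1); have b0 := exprn_ge0 2 (normr_ge0 q.2).
split; rewrite -(@ler_pXn2r _ 2) ?nnegrE ?sqrtr_ge0 // sqr_sqrtr ?addr_ge0 //; lra.
Qed.

Lemma graph_of_M q : enorm q <= r -> M q -> q.2 = f q.1.
Proof.
move=> hq Mq; have : (M `&` eclosed_ball 0 r) q by split=> //; rewrite /eclosed_ball /= subr0.
by rewrite hgraph => -[].
Qed.

Lemma M_of_graph q : enorm q <= r -> q.2 = f q.1 -> M q.
Proof.
move=> hq E; have : [set q | eclosed_ball 0 r q /\ q.2 = p_t t q.1 + F q.1] q.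
  by split=> //; rewrite /eclosed_ball /= subr0.
by rewrite -hgraph => -[].
Qed.

(** The condition on [F] concerns a punctured neighbourhood only; its value at 0 is fixed by the
    origin lying on the surface. *)
Lemma F_origin : F 0 = 0.
Proof.
have := graph_of_M _ M0; rewrite /= p_t0 add0r => <- //.
by apply: le_trans (enorm_le _) _; rewrite /= normr0 addr0 ltW.
Qed.

Lemma F_little_o (e : R) : 0 < e ->
  exists2 d : R, 0 < d & forall z, nrm z <= d -> nrm (F z) <= e * nrm z ^+ 3.
Proof.
move=> e0; have /eqoP/(_ e e0) h := hF.
have [d d0 hd] := nbhs_closed_ball (h : nbhs (0 : C) _).
exists d => // z hz; have [->|z0] := eqVneq z 0.
  by rewrite F_origin normr0 mulr_ge0 ?(ltW e0) // exprn_ge0.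
have := hd z; rewrite subr0 => /(_ hz z0).
by rewrite [`| `|z| ^+ 3|]ger0_norm // exprn_ge0.
Qed.

Lemma p_t_norm z : nrm (p_t t z) <= (1 + t + t ^+ 2 / 3) * nrm z ^+ 3.
Proof.
rewrite /p_t; apply: le_trans (ler_normD _ _) _.
apply: le_trans (lerD (ler_normD _ _) (lexx _)) _.
have sc (a : R) (x : C) : 0 <= a -> nrm (a *: x) = a * nrm x.
  by move=> a0; rewrite normrZ ger0_norm.
have t3 : 0 <= t ^+ 2 / 3 by rewrite divr_ge0 // exprn_ge0 // ltW.
rewrite (sc _ _ t3) (sc _ _ (ltW t0)) !(RcnormX, RcnormM) !RcnormJ.
by rewrite le_eqVlt; apply/orP; left; apply/eqP; ring.
Qed.

(** The second bound makes the max norm of [(z, f z)] equal to [|z|]. *)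
Lemma graph_norm : exists2 d : R, 0 < d & forall z, nrm z <= d ->
  nrm (f z) <= (2 + t + t ^+ 2 / 3) * nrm z ^+ 3 /\ nrm (f z) <= nrm z.
Proof.
have [d d0 hd] := F_little_o ltr01.
pose B := 2 + t + t ^+ 2 / 3.
have B1 : 1 <= B.
  by have := exprn_ge0 2 (ltW t0); have := t0; rewrite /B; lra.
have B0 : 0 < B by lra.
exists (Num.min d (Num.min 1 B^-1)); first by rewrite !lt_min d0 ltr01 invr_gt0.
move=> z; rewrite !le_min => /and3P[hz z1 zB].
have h : nrm (f z) <= B * nrm z ^+ 3.
  apply: le_trans (ler_normD _ _) _.
  by have := p_t_norm z; have := hd z hz; rewrite /B; lra.
split=> //; apply: le_trans h _; rewrite exprS expr2.
have h1 : B * nrm z <= 1 by rewrite -ler_pdivlMl // mulr1.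
have h2 : nrm z * nrm z <= nrm z by rewrite ler_piMr.
have -> : B * (nrm z * (nrm z * nrm z)) = (B * nrm z) * (nrm z * nrm z) by ring.
have := ler_pM (mulr_ge0 (ltW B0) (normr_ge0 z)) (mulr_ge0 (normr_ge0 z) (normr_ge0 z)) h1 h2.
by rewrite mul1r.
Qed.

End GraphRegularity.

(** * Transfer of the smoothness of the surface to the remainder *)

Section Chart.
Variable R : realType.
Local Notation C := (Rcomplex R).
Local Notation nrm x := (`|(x : C)|).
Local Notation Re := (@complex.Re R).
Local Notation Im := (@complex.Im R).
Variables (t r : R) (M : set (C2 R)) (F : C -> C).
Hypothesis t0 : 0 < t.
Hypothesis M0 : M 0.
Hypothesis r0 : 0 < r.
Hypothesis hgraph : M `&` eclosed_ball 0 r =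
  [set q | eclosed_ball 0 r q /\ q.2 = p_t t q.1 + F q.1].
Hypothesis hF : F =o_ ((0 : C)^') (fun z => `|z| ^+ 3 : R).
Variables (U U' : set (C2 R)) (Phi Psi : C2 R -> C2 R).
Hypothesis oU : open U.
Hypothesis U0 : U 0.
Hypothesis oU' : open U'.
Hypothesis cPhi : class_C 3 U Phi.
Hypothesis PhiK : forall q, U q -> U' (Phi q) /\ Psi (Phi q) = q.
Hypothesis cPsi : class_C 3 U' Psi.
Hypothesis PsiK : forall q, U' q -> U (Psi q) /\ Phi (Psi q) = q.
Hypothesis slice : forall q, U q -> (M q <-> (Phi q).2 = 0).

Local Notation f z := (p_t t (z : C) + F z).

Definition slice_pt : C := (Phi 0).1.
Definition slice_dom : set C := @horizontal R @^-1` U'.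
Definition param (x : C) : C2 R := Psi (horizontal x).

Lemma horizontal_slice_pt : horizontal slice_pt = Phi 0.
Proof.
have := (slice U0).1 M0; rewrite /horizontal /slice_pt; case: (Phi 0) => a b /= ->.
by [].
Qed.

Lemma slice_dom_pt : slice_dom slice_pt.
Proof. by rewrite /slice_dom /= horizontal_slice_pt; exact: (PhiK U0).1. Qed.

Lemma open_slice_dom : open slice_dom.
Proof. by apply: open_comp => // x _; exact: continuous_horizontal. Qed.

Lemma param_pt : param slice_pt = 0.
Proof. by rewrite /param horizontal_slice_pt; exact: (PhiK U0).2. Qed.

Lemma param_class (g : {linear C2 R -> R^o}) : continuous g ->
  class_C 3 slice_dom (fun x => g (param x) : R).
Proof.
move=> cg; have := class_C_comp_linear oU' cg cPsi.
exact: (class_C_precomp_linear (@continuous_horizontal R)).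
Qed.

Lemma param_graph (e : R) : 0 < e -> exists2 d : R, 0 < d & forall x,
  nrm (x - slice_pt) <= d ->
  [/\ slice_dom x, `|param x| <= e & (param x).2 = f (param x).1].
Proof.
move=> e0; pose c := Num.min e (r / 2).
have c0 : 0 < c by rewrite lt_min e0 divr_gt0.
have cp : {for slice_pt, continuous param}.
  apply: continuous_comp; first exact: continuous_horizontal.
  have h := class_C_le (leq0n 3) cPsi.
  by apply: h; exact: slice_dom_pt.
have [da da0 hda] := continuous_close cp c0.
have [db db0 hdb] := nbhs_closed_ball (open_nbhs_nbhs (conj open_slice_dom slice_dom_pt)).
exists (Num.min da db); first by rewrite lt_min da0.
move=> x; rewrite le_min => /andP[/hda + /hdb Vx].
rewrite param_pt subr0 le_min => /andP[pe pr]; split=> //.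
have [Ux Ex] := PsiK Vx.
apply: (graph_of_M hgraph).
  apply: le_trans (enorm_le _) _.
  by have := fst_le (param x); have := snd_le (param x); lra.
by apply/(slice Ux); rewrite /param Ex.
Qed.

Lemma param_lipschitz : exists2 L : R, 0 < L & exists2 d : R, 0 < d &
  forall x, nrm (x - slice_pt) <= d -> nrm (param x).1 <= L * nrm (x - slice_pt).
Proof.
have lip (g : {linear C2 R -> R^o}) : continuous g ->
    exists2 L : R, 0 < L & exists2 d : R, 0 < d & forall x,
      nrm (x - slice_pt) <= d -> `|g (param x) : R| <= L * nrm (x - slice_pt).
  move=> cg; have cl := class_C_le (isT : (1 <= 3)%N) (param_class cg).
  pose h (x : C) : R := g (param x).
  pose m := `|'D_1 h slice_pt| + `|'D_('i%C : C) h slice_pt|.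
  have m1 : `|'D_1 h slice_pt| <= m by rewrite lerDl.
  have m2 : `|'D_('i%C : C) h slice_pt| <= m by rewrite lerDr.
  have [d d0 hd] := class_C1_lipschitz_C open_slice_dom slice_dom_pt cl m1 m2 ltr01.
  exists (2 * (m + 1)); first by rewrite mulr_gt0 // ltr_wpDl // addr_ge0.
  exists d => // x hx; have := hd slice_pt x _ hx.
  by rewrite subrr normr0 param_pt linear0 subr0 => /(_ (ltW d0)).
have [L1 L10 [d1 d10 h1]] := lip _ (@continuous_re1 R).
have [L2 L20 [d2 d20 h2]] := lip _ (@continuous_im1 R).
exists (L1 + L2); first by rewrite addr_gt0.
exists (Num.min d1 d2); first by rewrite lt_min d10.
move=> x; rewrite le_min => /andP[/h1 k1 /h2 k2].
by rewrite mulrDl; apply: le_trans (norm_le_ReIm _) (lerD k1 k2).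
Qed.

(** The second coordinate of [param] is a quadratically small C^1 function, so its differential
    vanishes at [slice_pt]. This replaces an inverse function theorem: it makes the first coordinate
    usable as a parameter. *)
Lemma param_snd_small (e : R) : 0 < e -> exists2 d : R, 0 < d & forall x y,
  nrm (x - slice_pt) <= d -> nrm (y - slice_pt) <= d ->
  nrm ((param y).2 - (param x).2) <= e * nrm (y - x).
Proof.
move=> e0; have e4 : 0 < e / 4 by lra.
have [L L0 [dl dl0 hl]] := param_lipschitz.
have [dg dg0 hg] := graph_norm t0 M0 r0 hgraph hF.
pose B := 2 + t + t ^+ 2 / 3.
have B0 : 0 <= B by have := exprn_ge0 2 (ltW t0); have := t0; rewrite /B; lra.
pose c := Num.min dg 1; have c0 : 0 < c by rewrite lt_min dg0 ltr01.
have [dp dp0 hp] := param_graph c0.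
pose d := Num.min dl dp; have d0 : 0 < d by rewrite lt_min dl0.
have quad x : nrm (x - slice_pt) <= d ->
    nrm (param x).2 <= (B * L ^+ 2) * nrm (x - slice_pt) ^+ 2.
  rewrite le_min => /andP[/hl h1 /hp[_ + E]].
  rewrite le_min => /andP[/(le_trans (fst_le _)) hc /(le_trans (fst_le _)) h11].
  rewrite E; have [h3 _] := hg _ hc; apply: le_trans h3 _.
  rewrite -mulrA -exprMn -/B ler_wpM2l //.
  apply: (@le_trans _ _ (nrm (param x).1 ^+ 2)).
    by rewrite exprSr ler_piMr // exprn_ge0.
  by rewrite ler_pXn2r // nnegrE // mulr_ge0 // ltW.
have lip (g : {linear C2 R -> R^o}) : continuous g ->
    (forall q, `|g q : R| <= nrm q.2) ->
    exists2 d' : R, 0 < d' & forall x y,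
      nrm (x - slice_pt) <= d' -> nrm (y - slice_pt) <= d' ->
      `|g ((param y)) - g (param x) : R| <= e / 2 * nrm (y - x).
  move=> cg hg2; have cl := class_C_le (isT : (1 <= 3)%N) (param_class cg).
  pose h (x : C) : R := g (param x).
  have hq x : nrm (x - slice_pt) <= d -> `|h x| <= (B * L ^+ 2) * nrm (x - slice_pt) ^+ 2.
    by move=> hx; apply: le_trans (hg2 _) (quad _ hx).
  have D1 := derive_quadratic0 open_slice_dom slice_dom_pt (Rcnorm1 R) cl d0 hq.
  have D2 := derive_quadratic0 open_slice_dom slice_dom_pt (norm_i R) cl d0 hq.
  have m1 : `|'D_1 h slice_pt| <= 0 by rewrite D1 normr0.
  have m2 : `|'D_('i%C : C) h slice_pt| <= 0 by rewrite D2 normr0.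
  have [d' d'0 hd'] := class_C1_lipschitz_C open_slice_dom slice_dom_pt cl m1 m2 e4.
  exists d' => // x y hx hy; apply: le_trans (hd' _ _ hx hy) _.
  by rewrite add0r (_ : 2 * (e / 4) = e / 2) //; field.
have [d1 d10 h1] := lip _ (@continuous_re2 R) (fun q => Re_le_norm q.2).
have [d2 d20 h2] := lip _ (@continuous_im2 R) (fun q => Im_le_norm q.2).
exists (Num.min d1 d2); first by rewrite lt_min d10.
move=> x y; rewrite !le_min => /andP[x1 x2] /andP[y1 y2].
apply: le_trans (norm_le_ReIm _) _; rewrite !ReImE.
by have := h1 _ _ x1 y1; have := h2 _ _ x2 y2; rewrite /= /re2 /im2; lra.
Qed.

Lemma chart_lipschitz : exists2 L : R, 0 < L & exists2 d : R, 0 < d &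
  forall q q' : C2 R, `|q| <= d -> `|q'| <= d ->
    nrm ((Phi q').1 - (Phi q).1) <= L * (nrm (q'.1 - q.1) + nrm (q'.2 - q.2)).
Proof.
have lip (g : {linear C2 R -> R^o}) : continuous g ->
    exists2 L : R, 0 < L & exists2 d : R, 0 < d & forall q q' : C2 R,
      `|q| <= d -> `|q'| <= d ->
      `|g (Phi q') - g (Phi q) : R| <= L * (nrm (q'.1 - q.1) + nrm (q'.2 - q.2)).
  move=> cg.
  have cl := class_C_le (isT : (1 <= 3)%N) (class_C_comp_linear oU cg cPhi).
  have [L L0 [d d0 h]] := class_C1_lipschitz_C2 oU U0 cl.
  exists L => //; exists d => // q q' hq hq'.
  by apply: h; rewrite subr0.
have [L1 L10 [d1 d10 h1]] := lip _ (@continuous_re1 R).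
have [L2 L20 [d2 d20 h2]] := lip _ (@continuous_im1 R).
exists (L1 + L2); first by rewrite addr_gt0.
exists (Num.min d1 d2); first by rewrite lt_min d10.
move=> q q'; rewrite !le_min => /andP[x1 x2] /andP[y1 y2].
apply: le_trans (norm_le_ReIm _) _; rewrite !ReImE mulrDl.
by apply: lerD; [exact: h1|exact: h2].
Qed.

(** [F] is not assumed smooth. Along the surface, however, it equals [w - p_t(z)], a polynomial in
    the real coordinates of [param], hence C^3 in the chart variable. *)
Lemma remainder_flat (e : R) : 0 < e -> exists2 d : R, 0 < d &
  forall (rho : R) x y, 0 < rho <= d -> nrm (x - slice_pt) <= rho ->
    nrm (y - slice_pt) <= rho ->
    nrm (F (param y).1 - F (param x).1) <= e * rho ^+ 2 * nrm (y - x).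
Proof.
move=> e0; have e2 : 0 < e / 2 by lra.
have oV := open_slice_dom; have V0 := slice_dom_pt.
pose X x : R := re1 (param x); pose Y x : R := im1 (param x).
have cX : class_C 3 slice_dom X := param_class (@continuous_re1 R).
have cY : class_C 3 slice_dom Y := param_class (@continuous_im1 R).
pose pR x := (1 + t) * (X x * (X x * X x + Y x * Y x)) +
  t ^+ 2 / 3 * (X x * (X x * X x) - 3 * (X x * (Y x * Y x))).
pose pI x := (1 - t) * (Y x * (X x * X x + Y x * Y x)) -
  t ^+ 2 / 3 * (3 * (X x * (X x * Y x)) - Y x * (Y x * Y x)).
have cst (c : R) : class_C 3 slice_dom (fun=> c) by exact: class_C_cst.
have cM (g h : C -> R) : class_C 3 slice_dom g -> class_C 3 slice_dom h ->
    class_C 3 slice_dom (fun x => g x * h x) by exact: class_CM.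
have cD (g h : C -> R) : class_C 3 slice_dom g -> class_C 3 slice_dom h ->
    class_C 3 slice_dom (fun x => g x + h x) by exact: class_CD.
have cB (g h : C -> R) : class_C 3 slice_dom g -> class_C 3 slice_dom h ->
    class_C 3 slice_dom (fun x => g x - h x) by exact: class_CB.
have cN := cD _ _ (cM _ _ cX cX) (cM _ _ cY cY).
have cpR : class_C 3 slice_dom pR := cD _ _ (cM _ _ (cst (1 + t)) (cM _ _ cX cN))
  (cM _ _ (cst (t ^+ 2 / 3)) (cB _ _ (cM _ _ cX (cM _ _ cX cX))
    (cM _ _ (cst 3) (cM _ _ cX (cM _ _ cY cY))))).
have cpI : class_C 3 slice_dom pI := cB _ _ (cM _ _ (cst (1 - t)) (cM _ _ cY cN))
  (cM _ _ (cst (t ^+ 2 / 3)) (cB _ _ (cM _ _ (cst 3) (cM _ _ cX (cM _ _ cX cY)))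
    (cM _ _ cY (cM _ _ cY cY)))).
have pE x : Re (p_t t (param x).1) = pR x /\ Im (p_t t (param x).1) = pI x.
  by rewrite /p_t /pR /pI /X /Y /re1 /im1 !exprS expr0; split; rewrite !ReImE /=; field.
have [L L0 [dl dl0 hl]] := param_lipschitz.
have small (g : {linear C2 R -> R^o}) (p : C -> R) : continuous g ->
    class_C 3 slice_dom p ->
    (forall x, (param x).2 = f (param x).1 ->
      `|(g (param x) : R) - p x| <= nrm (F (param x).1)) ->
    exists2 d : R, 0 < d & forall (rho : R) x y, 0 < rho <= d ->
      nrm (x - slice_pt) <= rho -> nrm (y - slice_pt) <= rho ->
      `|((g (param y) : R) - p y) - ((g (param x) : R) - p x)| <=
        e / 2 * rho ^+ 2 * nrm (y - x).
  move=> cg cp hp; have cgp := cB _ _ (param_class cg) cp.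
  apply: (flat_lipschitz oV V0 cgp _ e2) => e' e'0.
  have e'' : 0 < e' / L ^+ 3 by rewrite divr_gt0 // exprn_gt0.
  have [da da0 hda] := F_little_o M0 r0 hgraph hF e''.
  have [db db0 hdb] := param_graph da0.
  exists (Num.min dl db); first by rewrite lt_min dl0.
  move=> x; rewrite le_min => /andP[/hl h1 /hdb[_ h2 E]].
  apply: le_trans (hp _ E) _; apply: le_trans (hda _ (le_trans (fst_le _) h2)) _.
  apply: (@le_trans _ _ (e' / L ^+ 3 * (L * nrm (x - slice_pt)) ^+ 3)).
    rewrite ler_wpM2l ?(ltW e'') //.
    by rewrite ler_pXn2r // nnegrE // mulr_ge0 // ltW.
  by rewrite exprMn mulrA divfK // expf_neq0 // gt_eqF.
have ReF x : (param x).2 = f (param x).1 ->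
    (re2 (param x) : R) - pR x = Re (F (param x).1).
  by move=> E; rewrite /re2 E ReD (pE x).1; ring.
have ImF x : (param x).2 = f (param x).1 ->
    (im2 (param x) : R) - pI x = Im (F (param x).1).
  by move=> E; rewrite /im2 E ImD (pE x).2; ring.
have [|d1 d10 h1] := small _ pR (@continuous_re2 R) cpR.
  by move=> x /ReF ->; exact: Re_le_norm.
have [|d2 d20 h2] := small _ pI (@continuous_im2 R) cpI.
  by move=> x /ImF ->; exact: Im_le_norm.
have [d3 d30 h3] := param_graph ltr01.
exists (Num.min d1 (Num.min d2 d3)); first by rewrite !lt_min d10 d20.
move=> rho x y; rewrite !le_min => /andP[rho0 /and3P[rd1 rd2 rd3]] hx hy.
have [_ _ Ex] := h3 x (le_trans hx rd3); have [_ _ Ey] := h3 y (le_trans hy rd3).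
have := h1 rho x y; rewrite rho0 rd1 (ReF _ Ex) (ReF _ Ey) => /(_ isT hx hy) k1.
have := h2 rho x y; rewrite rho0 rd2 (ImF _ Ex) (ImF _ Ey) => /(_ isT hx hy) k2.
apply: le_trans (norm_le_ReIm _) _; rewrite !ReImE.
have -> : e * rho ^+ 2 * nrm (y - x) =
  e / 2 * rho ^+ 2 * nrm (y - x) + e / 2 * rho ^+ 2 * nrm (y - x) by field.
exact: lerD k1 k2.
Qed.

(** With [x], [y] the chart variables of the graph points over [z], [a]: [|x - y|] is at most [L]
    times the sum of the coordinate differences, and the second of these is at most
    [|x - y| / (2 L)]. Absorbing it gives [|x - y| <= 2 L |z - a|]. *)
Lemma chart_remainder_lipschitz (e : R) : 0 < e -> exists2 d : R, 0 < d &
  forall (rho : R) z a, rho <= d -> nrm z <= rho -> nrm a <= rho ->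
    nrm (F z - F a) <= e * rho ^+ 2 * nrm (z - a).
Proof.
move=> e0; have [L L0 [dc dc0 hc]] := chart_lipschitz.
have [dg dg0 hg] := graph_norm t0 M0 r0 hgraph hF.
have eL : 0 < (2 * L)^-1 by rewrite invr_gt0 mulr_gt0.
have [ds ds0 hs] := param_snd_small eL.
(* Two factors [2 L] come from the radius [2 L rho], squared, and one from
   [|x - y| <= 2 L |z - a|]. *)
pose h := e / (8 * L ^+ 3).
have h0 : 0 < h by rewrite divr_gt0 // mulr_gt0 // exprn_gt0.
have [df df0 hf] := remainder_flat h0.
have [du du0 hdu] := nbhs_closed_ball (open_nbhs_nbhs (conj oU U0)).
pose D := Num.min ds df; have D0 : 0 < D by rewrite lt_min ds0.
have T0 : 0 < D / (2 * L) by rewrite divr_gt0 // mulr_gt0.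
exists (Num.min dc (Num.min dg (Num.min du (Num.min (r / 2) (D / (2 * L)))))).
  by rewrite !lt_min dc0 dg0 du0 T0 divr_gt0.
move=> rho z a; rewrite !le_min => /and5P[rc rg ru rr rD] hz ha.
have rho0 : 0 <= rho := le_trans (normr_ge0 _) hz.
have [r00|rn0] := eqVneq rho 0.
  move: hz ha; rewrite r00 => /(le_trans _) hz /(le_trans _) ha.
  have z0 : z = 0 by apply/eqP; rewrite -normr_le0; apply: hz.
  have a0 : a = 0 by apply/eqP; rewrite -normr_le0; apply: ha.
  by rewrite z0 a0 !subrr normr0 mulr0.
have rp : 0 < rho by rewrite lt_neqAle eq_sym rn0.
have pt x : nrm x <= rho -> let q : C2 R := (x, f x) in
    [/\ `|q| <= rho, param (Phi q).1 = q &
        nrm ((Phi q).1 - slice_pt) <= 2 * L * rho].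
  move=> hx q; have [_ fx] := hg x (le_trans hx rg).
  have hq : `|q| <= rho by rewrite C2_norm_le /= hx; exact: le_trans fx hx.
  have Uq : U q by apply: hdu; rewrite subr0; exact: le_trans hq ru.
  have Mq : M q.
    apply: (M_of_graph hgraph) => //; apply: le_trans (enorm_le _) _ => /=.
    by have := le_trans fx hx; lra.
  split=> //.
    rewrite /param -[RHS](PhiK Uq).2; congr Psi.
    by move: ((slice Uq).1 Mq); rewrite /horizontal; case: (Phi q) => u v /= ->.
  have := hc 0 q; rewrite normr0 => /(_ (ltW dc0) (le_trans hq rc)); rewrite /= !subr0.
  move=> h1; apply: le_trans h1 _.
  have -> : 2 * L * rho = L * (rho + rho) by ring.
  by rewrite ler_wpM2l ?(ltW L0) // lerD //; exact: le_trans fx hx.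
have [qz Ez nz] := pt z hz; have [qa Ea na] := pt a ha.
set x := (Phi (z, f z)).1 in Ez nz; set y := (Phi (a, f a)).1 in Ea na.
have LD : 2 * L * rho <= D.
  by rewrite mulrC -ler_pdivlMr // mulr_gt0.
move: (LD); rewrite le_min => /andP[Ls Lf].
have xy : nrm (x - y) <= 2 * L * nrm (z - a).
  have h1 := hc _ _ (le_trans qa rc) (le_trans qz rc).
  have h2 := hs _ _ (le_trans na Ls) (le_trans nz Ls).
  rewrite Ez Ea /= in h2; rewrite /= -/x -/y in h1.
  have h3 := ler_wpM2l (ltW L0) h2.
  have Lw w : L * ((2 * L)^-1 * w) = w / 2 by field; rewrite gt_eqF.
  rewrite Lw in h3.
  by rewrite mulrDr in h1; lra.
have := hf (2 * L * rho) y x; rewrite Ez Ea /= => h1.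
apply: le_trans (h1 _ na nz) _; first by rewrite !mulr_gt0.
apply: le_trans (ler_wpM2l _ xy) _; first by rewrite mulr_ge0 ?(ltW h0) // exprn_ge0 // !mulr_ge0 // ltW.
rewrite le_eqVlt; apply/orP; left; apply/eqP; rewrite /h; field.
by rewrite gt_eqF.
Qed.

End Chart.

(** * Compactness *)

Section Compactness.
Variable R : realType.
Local Notation C := (Rcomplex R).
Local Notation nrm x := (`|(x : C)|).
Local Notation Re := (@complex.Re R).
Local Notation Im := (@complex.Im R).

Lemma compact_disc_superset (rho : R) : exists2 A : set C, compact A &
  forall z, nrm z <= rho -> A z.
Proof.
pose mk (x : R * R) : C := x.1 *: 1 + x.2 *: ('i%C : C).
exists (mk @` (`[- rho, rho] `*` `[- rho, rho])).
  apply: continuous_compact; last by apply: compact_setX; exact: segment_compact.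
  apply: continuous_subspaceT => x; apply: cvgD; apply: cvgZ; try exact: cvg_cst; first [exact: cvg_fst|exact: cvg_snd].
move=> z hz; exists (Re z, Im z); last by rewrite /mk /= -ReIm_decomp.
by split; rewrite /= in_itv /= -ler_norml; apply: le_trans hz; [exact: Re_le_norm|exact: Im_le_norm].
Qed.

Lemma enorm_continuous_closed (rho : R) : 0 <= rho -> closed [set q : C2 R | enorm q <= rho].
Proof.
move=> rho0; have n1 : continuous (fun q : C2 R => nrm q.1 : R).
  by move=> q; apply: (continuous_comp (f := fst)); [exact: cvg_fst|exact: norm_continuous].
have n2 : continuous (fun q : C2 R => nrm q.2 : R).
  by move=> q; apply: (continuous_comp (f := snd)); [exact: cvg_snd|exact: norm_continuous].
have -> : [set q : C2 R | enorm q <= rho] =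
    (fun q : C2 R => nrm q.1 * nrm q.1 + nrm q.2 * nrm q.2 : R) @^-1` [set x | x <= rho ^+ 2].
  apply/seteqP; split=> q /=; rewrite -!expr2.
    move=> h; rewrite -[leLHS]sqr_sqrtr ?addr_ge0 ?exprn_ge0 //.
    by rewrite ler_pXn2r ?nnegrE ?sqrtr_ge0.
  move=> h; rewrite -(@ler_pXn2r _ 2) ?nnegrE ?sqrtr_ge0 //.
  by rewrite sqr_sqrtr ?addr_ge0 ?exprn_ge0.
apply: preimage_closed; last exact: closed_le.
by move=> q _; apply: cvgD; apply: cvgM; first [exact: n1|exact: n2].
Qed.

(** [M] is not assumed closed. In [U] it is the zero set of a continuous function, which makes it
    closed in small balls. *)
Lemma slice_compact (M U : set (C2 R)) (Phi : C2 R -> C2 R) : open U -> U 0 ->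
  class_C 0 U Phi -> (forall q, U q -> (M q <-> (Phi q).2 = 0)) ->
  exists2 d : R, 0 < d & forall rho : R, 0 <= rho <= d ->
    compact (M `&` eclosed_ball 0 rho).
Proof.
move=> oU U0 cPhi slice.
have [d d0 hd] := nbhs_closed_ball (open_nbhs_nbhs (conj oU U0)).
exists d => // rho /andP[rho0 rd].
have -> : eclosed_ball 0 rho = [set q : C2 R | enorm q <= rho].
  by apply/seteqP; split=> q; rewrite /eclosed_ball /= subr0.
have EU q : enorm q <= rho -> U q.
  move=> hq; apply: hd; rewrite subr0 C2_norm_le.
  by have [h1 h2] := le_enorm q; rewrite !(le_trans _ rd) // (le_trans _ hq).
have [A cA hA] := compact_disc_superset rho.
apply: (subclosed_compact _ (compact_setX cA cA)); last first.
  move=> q [_ hq]; have [h1 h2] := le_enorm q.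
  by split; apply: hA; exact: le_trans hq.
move=> q clq; have Eq : enorm q <= rho.
  apply: (enorm_continuous_closed rho0) => B /clq[q' [[_ Eq'] Bq']].
  by exists q'.
split=> //; apply/(slice _ (EU _ Eq)); apply: contrapT => /eqP nz.
have Uq := EU _ Eq.
have e0 : 0 < nrm (Phi q).2 / 2 by rewrite divr_gt0 // normr_gt0.
have /cvgrPdist_le/(_ _ e0) near : Phi @ q --> Phi q := cPhi _ Uq.
have [q' [[Mq' Eq'] hq']] := clq _ near.
have z := (slice _ (EU _ Eq')).1 Mq'.
have := le_trans (snd_le (Phi q - Phi q')) hq'; rewrite /= z subr0.
by move: e0; set a := nrm _; lra.
Qed.

End Compactness.

(** * Elementary properties of the polynomial hull *)

Section Hulls.
Variable R : realType.
Local Notation C := (Rcomplex R).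
Local Notation nrm x := (`|(x : C)|).

Lemma poly_approx_eval2 (D : set (C2 R)) (M : R) (p : {poly {poly C}}) :
  (forall q, D q -> `|q| <= M) -> poly_approx D (eval2 p).
Proof.
move=> hD; have A1 : poly_approx D (fun q => q.1).
  by apply: (poly_approx1 (M := M)) => q /hD; exact: le_trans (fst_le q).
have A2 : poly_approx D (fun q => q.2).
  by apply: (poly_approx2 (M := M)) => q /hD; exact: le_trans (snd_le q).
elim/poly_ind: p => [|p c IH].
  apply: (poly_approx_eq (f := fun=> 0)) => [q _|]; last exact: poly_approx_cst.
  by rewrite /eval2 !horner0.
apply: (poly_approx_eq (f := fun q => eval2 p q * q.1 + c.[q.2])) => [q _|].
  by rewrite eval2D eval2M eval2X /eval2 hornerC.
apply: poly_approxD; first exact: poly_approxM.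
elim/poly_ind: c => [|c a IHc].
  apply: (poly_approx_eq (f := fun=> 0)) => [q _|]; last exact: poly_approx_cst.
  by rewrite horner0.
apply: (poly_approx_eq (f := fun q => c.[q.2] * q.2 + a)) => [q _|].
  by rewrite hornerD hornerM hornerX hornerC.
by apply: poly_approxD; [exact: poly_approxM|exact: poly_approx_cst].
Qed.

(** [sup] bounds the values of [|p|] only if these are bounded, which boundedness of [K] ensures. *)
Lemma subset_hull (K : set (C2 R)) (M : R) : (forall q, K q -> `|q| <= M) ->
  K `<=` polynomial_hull K.
Proof.
move=> hK q Kq p; have [[B hB] _] := poly_approx_eval2 p hK.
apply: ub_le_sup; last by exists q.
by exists B => _ [x Kx <-]; exact: hB.
Qed.

(** Nonemptiness matters because [sup] of the empty set is 0, which need not lie below [M]. *)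
Lemma hull_bound (K : set (C2 R)) (q0 : C2 R) (p : {poly {poly C}}) (M : R) :
  K !=set0 -> polynomial_hull K q0 -> (forall q, K q -> nrm (eval2 p q) <= M) ->
  nrm (eval2 p q0) <= M.
Proof.
move=> [q Kq] h hM; apply: le_trans (h p) _; apply: ge_sup; first by exists (nrm (eval2 p q)), q.
by move=> _ [x Kx <-]; exact: hM.
Qed.

(* Cauchy-Schwarz: the linear polynomial [conj a z + conj b w] separates
   [(a, b)] from a Euclidean ball that does not contain it. *)
Lemma hull_ball (K : set (C2 R)) (q0 : C2 R) (rho : R) : K !=set0 ->
  (forall q, K q -> enorm q <= rho) -> polynomial_hull K q0 -> enorm q0 <= rho.
Proof.
move=> K0 hK hq0.
pose p : {poly {poly C}} := (conjc q0.1 : C)%:P%:P * 'X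
  + (conjc q0.2 : C)%:P%:P * ('X : {poly C})%:P.
have pE q : eval2 p q = (conjc q0.1 : C) * q.1 + (conjc q0.2 : C) * q.2.
  by rewrite /p eval2D !eval2M !eval2C eval2X eval2Y.
have enormE (q : C2 R) : enorm q ^+ 2 = nrm q.1 ^+ 2 + nrm q.2 ^+ 2.
  by rewrite sqr_sqrtr // addr_ge0 // exprn_ge0.
have e0 (q : C2 R) : 0 <= enorm q by exact: sqrtr_ge0.
have CS q : nrm (eval2 p q) <= enorm q0 * enorm q.
  rewrite pE; apply: le_trans (ler_normD _ _) _; rewrite !RcnormM !RcnormJ.
  rewrite -(@ler_pXn2r _ 2) ?nnegrE ?addr_ge0 ?mulr_ge0 // exprMn !enormE.
  set a := nrm q0.1; set b := nrm q0.2; set x := nrm q.1; set y := nrm q.2.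
  have -> : (a ^+ 2 + b ^+ 2) * (x ^+ 2 + y ^+ 2) =
    (a * x + b * y) ^+ 2 + (a * y - b * x) ^+ 2 by ring.
  by rewrite lerDl sqr_ge0.
have : nrm (eval2 p q0) <= enorm q0 * rho.
  apply: hull_bound K0 hq0 _ => q Kq; apply: le_trans (CS q) _.
  by rewrite ler_wpM2l // hK.
have -> : nrm (eval2 p q0) = enorm q0 ^+ 2.
  have -> : eval2 p q0 = (enorm q0 ^+ 2) *: 1.
    rewrite pE enormE !Rcnorm_sqr.
    by apply: ReIm_inj; rewrite !ReImE /=; ring.
  by rewrite normrZ Rcnorm1 mulr1 ger0_norm // exprn_ge0.
have [->|n0] := eqVneq (enorm q0) 0.
  by move=> _; have [q Kq] := K0; exact: le_trans (e0 q) (hK _ Kq).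
by rewrite expr2 ler_pM2l // lt_neqAle eq_sym n0 e0.
Qed.

End Hulls.

Theorem theorem1p10 (R : realType) (k : nat) (t r : R) (M : set (C2 R))
    (F : Rcomplex R -> Rcomplex R)
    (hk : (3 <= k)%N)
    (ht : 0 < t)
    (hM : real_surface k M)
    (hCR : isolated_CR_singularity M 0)
    (hr : 0 < r)
    (hgraph : M `&` eclosed_ball 0 r =
      [set q | eclosed_ball 0 r q /\ q.2 = p_t t q.1 + F q.1])
    (hF : F =o_ ((0 : Rcomplex R)^') (fun z => `|z| ^+ 3 : R))
    (hts : Num.sqrt (3 / 2) <= t) :
  locally_polynomially_convex_at M 0.
Proof.
have M0 : M 0 by have [[]] := hCR.
have [U [U' [Phi [Psi [[oU U0] oU' [cPhi PhiK] [cPsi PsiK] slice]]]]] := hM 0 M0.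
have cPhi3 := class_C_le hk cPhi; have cPsi3 := class_C_le hk cPsi.
have t32 : 3 / 2 <= t ^+ 2.
  rewrite -[leLHS]sqr_sqrtr ?divr_ge0 //.
  by rewrite ler_pXn2r ?nnegrE ?sqrtr_ge0 // ltW.
(* The largest value that [e1_le] allows; it depends on [t] only and is fixed before any radius. *)
pose e1 : R := (250 * (1 + t) ^+ 2)^-1.
have T0 : 0 < 250 * (1 + t) ^+ 2.
  by apply: mulr_gt0; [lra|rewrite exprn_gt0 // addr_gt0].
have e10 : 0 < e1 by rewrite invr_gt0.
have e1_le : 250 * (1 + t) ^+ 2 * e1 <= 1 
  by rewrite /e1 divff; [exact: lexx|exact: lt0r_neq0].
have t3 : 0 < 3 * t by rewrite mulr_gt0.
have eta0 : 0 < e1 ^+ 3 / (3 * t) by rewrite divr_gt0 // exprn_gt0.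
have [d d0 F_lip] := chart_remainder_lipschitz ht M0 hr hgraph hF oU U0 oU' cPhi3 PhiK
  cPsi3 PsiK slice eta0.
have [c c0 cpt] := slice_compact oU U0 (class_C_le (leq0n _) cPhi) slice.
(* [d] is for the Lipschitz bound on [F], [c] for compactness, 1 for the estimates that use
   [|z| <= 1], and [r] for staying where [M] is a graph. *)
pose rho := Num.min (Num.min d c) (Num.min 1 r).
have rho0 : 0 < rho by rewrite !lt_min d0 c0 ltr01.
have : rho <= rho by []; rewrite {2}/rho !le_min => /andP[/andP[rd rc] /andP[r1 rr]].
split=> //; exists rho => //; split; first by apply: cpt; rewrite ltW.
set K := M `&` eclosed_ball 0 rho.
have Kball q : K q -> enorm q <= rho by move=> [_]; rewrite /eclosed_ball /= subr0.
have K0 : K !=set0.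
  exists 0; split=> //; rewrite /eclosed_ball /= subrr.
  by apply: le_trans (enorm_le _) _; rewrite /= normr0 addr0 ltW.
apply/seteqP; split=> [q0 hq0|]; last first.
  apply: (subset_hull (M := rho)) => q /Kball hq; rewrite C2_norm_le.
  by have [h1 h2] := le_enorm q; rewrite !(le_trans _ hq).
have q0ball := hull_ball K0 Kball hq0.
(* Convexity of the ball places [q0] over the disc where [F] is controlled, so that it remains only
   to put it on the graph. *)
have [q01 _] := le_enorm q0.
suff E : q0.2 = p_t t q0.1 + F q0.1.
  split; last by rewrite /eclosed_ball /= subr0.
  by apply: (M_of_graph hgraph) => //; exact: le_trans q0ball rr.
apply: (hull_graph (e1 := e1) (delta := rho) (K := K)) => //.
- exact: (F_origin M0 hr hgraph).
- move=> s z a hs hz ha; have := F_lip s z a (le_trans hs rd) hz ha.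
  rewrite -(ler_pM2l t3) => h; apply: le_trans h _.
  have -> : 3 * t * (e1 ^+ 3 / (3 * t) * s ^+ 2 * `|z - a|) = e1 ^+ 3 * s ^+ 2 * `|z - a|.
    by field; rewrite gt_eqF.
  exact: lexx.
- move=> q Kq; have hq := Kball _ Kq; have [h1 _] := le_enorm q; split.
    exact: le_trans h1 hq.
  by apply: (graph_of_M hgraph); [exact: le_trans hq rr|case: Kq].
- by move=> p B; apply: hull_bound.
exact: le_trans q01 q0ball.
Qed.
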